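(* Let $f,g\in\mathcal{SR}$. If $f_I$ takes values in $\mathbb C_I$ for every $I\in\mathbb S$, then the pointwise product $f\cdot g$ belongs to $\mathcal{SR}$. More generally, $f\cdot g$ is S-polyregular if and only if there exists a positive integer $k_0$ such that for every $I\in\mathbb S$ $$\mathcal Z(G_f)\cup\mathcal Z\left(\frac{\partial^{k_0}g_I}{\partial y^{k_0}}\right)=\mathbb C_I ,$$ where, for each $I\in\mathbb S$, $f_I=F_f+G_fJ$ with $J\in\mathbb S$ perpendicular to $I$ and $F_f,G_f:\mathbb C_I\to\mathbb C_I$ holomorphic, and $\mathcal Z(h)$ denotes the set of zeros in $\mathbb C_I$ of $h$.
   Context: $\mathbb H$ is the algebra of quaternions, $\mathbb S=\{I\in\mathbb H: I^2=-1\}$, and for $I\in\mathbb S$, $\mathbb C_I=\mathbb R+\mathbb R I$. For $f:\mathbb H\to\mathbb H$, $f_I=f|_{\mathbb C_I}$, regarded as a function of $(x,y)\in\mathbb R^2$ via $q=x+Iy$, and $\overline{\partial_I}=\frac12\left(\frac{\partial}{\partial x}+I\frac{\partial}{\partial y}\right)$, with $I$ acting by left multiplication. For a nonnegative integer $n$, $\mathcal{SR}_n$ (S-polyregular functions of level $n$) is the set of (sufficiently real differentiable) functions $f:\mathbb H\to\mathbb H$ with $\overline{\partial_I}^{\,n+1}f_I=0$ on $\mathbb C_I$ for every $I\in\mathbb S$; $\mathcal{SR}=\mathcal{SR}_0$ is the space of (left) slice regular functions on $\mathbb H$. A function is S-polyregular if it belongs to $\mathcal{SR}_n$ for some $n\ge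 0$. The dot product is the pointwise product $(f\cdot g)(q)=f(q)g(q)$. For $f\in\mathcal{SR}$ and $I\perp J$ in $\mathbb S$, the Splitting Lemma guarantees that holomorphic $F_f,G_f:\mathbb C_I\to\mathbb C_I$ with $f_I=F_f+G_fJ$ exist (they are unique, and the zero set of $G_f$ does not depend on the choice of $J$). *)

(* Defs.v *)
From HB Require Import structures.
From mathcomp Require Import all_boot all_order all_algebra.
From mathcomp Require Import all_classical all_reals all_analysis.
From mathcomp Require Import ring lra.

Set Implicit Arguments.
Unset Strict Implicit.
Unset Printing Implicit Defensive.

Import Order.TTheory GRing.Theory Num.Theory.
Import numFieldNormedType.Exports.

Local Open Scope classical_set_scope.
Local Open Scope ring_scope.

(* Quaternions a + b i + c j + d k, stored as the row of their coordinates.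
   The norm inherited from 'rV[R]_4 is the sup norm, not the Euclidean one;
   below it only serves as the source of the topology and of real
   differentiability, for which all norms on R^4 agree. *)
Definition quat (R : realType) : Type := 'rV[R]_4.

HB.instance Definition _ (R : realType) :=
  NormedModule.copy (quat R) 'rV[R]_4.

Section QuaternionAlgebra.
Variable R : realType.
Implicit Types p q r : quat R.

Definition mkquat (a b c d : R) : quat R :=
  \row_(i < 4) [:: a; b; c; d]`_i.

Definition qre q : R := q ord0 (inord 0).
Definition qi q : R := q ord0 (inord 1).
Definition qj q : R := q ord0 (inord 2).
Definition qk q : R := q ord0 (inord 3).

Lemma qreE a b c d : qre (mkquat a b c d) = a.
Proof. by rewrite /qre mxE inordK. Qed.
Lemma qiE a b c d : qi (mkquat a b c d) = b.
Proof. by rewrite /qi mxE inordK. Qed.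
Lemma qjE a b c d : qj (mkquat a b c d) = c.
Proof. by rewrite /qj mxE inordK. Qed.
Lemma qkE a b c d : qk (mkquat a b c d) = d.
Proof. by rewrite /qk mxE inordK. Qed.
Definition mkquatE := (qreE, qiE, qjE, qkE).

Lemma quatP p q :
  qre p = qre q -> qi p = qi q -> qj p = qj q -> qk p = qk q -> p = q.
Proof.
move=> e0 e1 e2 e3; apply/rowP => i; rewrite -[i]inord_val.
by case: i => [[|[|[|[|i]]]] Hi] //=.
Qed.

Lemma qreD p q : qre (p + q) = qre p + qre q. Proof. by rewrite /qre mxE. Qed.
Lemma qiD p q : qi (p + q) = qi p + qi q. Proof. by rewrite /qi mxE. Qed.
Lemma qjD p q : qj (p + q) = qj p + qj q. Proof. by rewrite /qj mxE. Qed.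
Lemma qkD p q : qk (p + q) = qk p + qk q. Proof. by rewrite /qk mxE. Qed.
Definition quatDE := (qreD, qiD, qjD, qkD).

Lemma qreZ a q : qre (a *: q) = a * qre q. Proof. by rewrite /qre mxE. Qed.
Lemma qiZ a q : qi (a *: q) = a * qi q. Proof. by rewrite /qi mxE. Qed.
Lemma qjZ a q : qj (a *: q) = a * qj q. Proof. by rewrite /qj mxE. Qed.
Lemma qkZ a q : qk (a *: q) = a * qk q. Proof. by rewrite /qk mxE. Qed.
Definition quatZE := (qreZ, qiZ, qjZ, qkZ).

Lemma qre0 : qre 0 = 0. Proof. by rewrite /qre mxE. Qed.
Lemma qi0 : qi 0 = 0. Proof. by rewrite /qi mxE. Qed.
Lemma qj0 : qj 0 = 0. Proof. by rewrite /qj mxE. Qed.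
Lemma qk0 : qk 0 = 0. Proof. by rewrite /qk mxE. Qed.
Definition quat0E := (qre0, qi0, qj0, qk0).

Definition qone : quat R := mkquat 1 0 0 0.

Definition qmul p q : quat R :=
  mkquat
    (qre p * qre q - qi p * qi q - qj p * qj q - qk p * qk q)
    (qre p * qi q + qi p * qre q + qj p * qk q - qk p * qj q)
    (qre p * qj q - qi p * qk q + qj p * qre q + qk p * qi q)
    (qre p * qk q + qi p * qj q - qj p * qi q + qk p * qre q).

Definition qconj q : quat R := mkquat (qre q) (- qi q) (- qj q) (- qk q).

Definition qdot p q : R :=
  qre p * qre q + qi p * qi q + qj p * qj q + qk p * qk q.

Definition qinv q : quat R := (qdot q q)^-1 *: qconj q.

Lemma qmulA : associative qmul.
Proof. by move=> p q r; apply: quatP; rewrite !mkquatE; ring. Qed.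

Lemma qmul1l : left_id qone qmul.
Proof. by move=> q; apply: quatP; rewrite !mkquatE; ring. Qed.

Lemma qmul1r : right_id qone qmul.
Proof. by move=> q; apply: quatP; rewrite !mkquatE; ring. Qed.

Lemma qmulDl : left_distributive qmul +%R.
Proof.
by move=> p q r; apply: quatP; rewrite !(mkquatE, quatDE); ring.
Qed.

Lemma qmulDr : right_distributive qmul +%R.
Proof.
by move=> p q r; apply: quatP; rewrite !(mkquatE, quatDE); ring.
Qed.

Lemma qone_neq0 : qone != 0.
Proof.
apply/eqP => /(congr1 qre); rewrite mkquatE quat0E.
by move/eqP; rewrite oner_eq0.
Qed.

Lemma qdot_eq0 q : (qdot q q == 0) = (q == 0).
Proof.
apply/eqP/eqP => [|->]; last by rewrite /qdot !quat0E; ring.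
by rewrite /qdot => q0; apply: quatP; rewrite quat0E; nra.
Qed.

End QuaternionAlgebra.

HB.instance Definition _ (R : realType) :=
  GRing.Zmodule_isNzRing.Build (quat R) (@qmulA R) (@qmul1l R) (@qmul1r R)
    (@qmulDl R) (@qmulDr R) (@qone_neq0 R).

Section QuaternionDivision.
Variable R : realType.
Implicit Types p q : quat R.

Lemma quatME p q : p * q = qmul p q. Proof. by []. Qed.
Lemma quat1E : 1 = qone R. Proof. by []. Qed.

Lemma qscalerAl (a : R) p q : a *: (p * q) = (a *: p) * q.
Proof.
by rewrite !quatME; apply: quatP; rewrite !(quatZE, mkquatE); ring.
Qed.

Lemma qscalerAr (a : R) p q : a *: (p * q) = p * (a *: q).
Proof.
by rewrite !quatME; apply: quatP; rewrite !(quatZE, mkquatE); ring.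
Qed.

Lemma qmulVq : {in [pred q : quat R | q != 0], left_inverse 1 (@qinv R) *%R}.
Proof.
move=> q; rewrite inE -qdot_eq0 => q0.
by rewrite quatME quat1E; apply: quatP; rewrite !(quatZE, mkquatE) /qdot;
  field; exact: q0.
Qed.

Lemma qmulqV : {in [pred q : quat R | q != 0], right_inverse 1 (@qinv R) *%R}.
Proof.
move=> q; rewrite inE -qdot_eq0 => q0.
by rewrite quatME quat1E; apply: quatP; rewrite !(quatZE, mkquatE) /qdot;
  field; exact: q0.
Qed.

Lemma qunitP p q : q * p = 1 /\ p * q = 1 -> p \in [pred q : quat R | q != 0].
Proof.
move=> [_ pq]; rewrite inE; apply/eqP => p0; move: pq.
by rewrite p0 mul0r => /esym/eqP; rewrite oner_eq0.
Qed.

Lemma qinv_out : {in [predC [pred q : quat R | q != 0]], @qinv R =1 id}.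
Proof.
move=> q; rewrite !inE negbK => /eqP->.
by apply: quatP; rewrite /qinv !(quatZE, mkquatE) !quat0E; ring.
Qed.

End QuaternionDivision.

HB.instance Definition _ (R : realType) :=
  GRing.Lmodule_isLalgebra.Build R (quat R) (@qscalerAl R).
HB.instance Definition _ (R : realType) :=
  GRing.Lalgebra_isAlgebra.Build R (quat R) (@qscalerAr R).
HB.instance Definition _ (R : realType) :=
  GRing.NzRing_hasMulInverse.Build (quat R) (@qmulVq R) (@qmulqV R)
    (@qunitP R) (@qinv_out R).

(* Functions of class C^k between real normed spaces. The directional form of
   the recursion is the usual notion when V is finite-dimensional. *)
Fixpoint of_class (R : realType) (V W : normedModType R) (k : nat)
    (f : V -> W) : Prop :=
  if k is k'.+1 then
    (forall x, differentiable f x) /\ (forall v, of_class k' ('D_v f))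
  else continuous f.

Section SlicePolyregular.
Variable R : realType.
Implicit Types (I J q : quat R) (f F G h : quat R -> quat R).

Definition imag_units : set (quat R) := [set I | I ^+ 2 = -1].

Definition perp I J : Prop := qdot I J = 0.

Definition slice I : set (quat R) :=
  [set q | exists x y : R, q = x%:A + y *: I].

(* At q = x + I y, 'D_1 and 'D_I are the partial derivatives in x and y of
   (x, y) |-> F (x + I y); for q in slice I they, and their iterates, only
   involve the values of F on slice I. So these operators applied to f
   compute the derivatives of the restriction f_I. *)
Definition slice_dy I F : quat R -> quat R := 'D_I F.

Definition dbar I F : quat R -> quat R :=
  fun q => 2^-1 *: ('D_1 F q + I * 'D_I F q).

Definition SR_level (n : nat) : set (quat R -> quat R) :=
  [set f | of_class n.+1 f /\
    forall I, imag_units I -> forall q, slice I q -> iter n.+1 (dbar I) f q = 0].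

Definition slice_regular : set (quat R -> quat R) := SR_level 0.

Definition S_polyregular : set (quat R -> quat R) :=
  [set f | exists n, SR_level n f].

Definition maps_slice I F : Prop := forall q, slice I q -> slice I (F q).

(* Complex differentiability on slice I, a copy of the complex plane; values
   of F outside slice I are irrelevant. *)
Definition holomorphic_on_slice I F : Prop :=
  forall p, slice I p -> exists2 l, slice I l &
    (F q - F p) / (q - p) @[q --> within (slice I) p^'] --> l.

Definition splitting I J f F G : Prop :=
  [/\ maps_slice I F, holomorphic_on_slice I F,
      maps_slice I G, holomorphic_on_slice I G
    & forall q, slice I q -> f q = F q + G q * J].

Definition zeros I h : set (quat R) := [set q | slice I q /\ h q = 0].

End SlicePolyregular.

(* Main.v *)
Require Import Defs.
From HB Require Import structures.
From mathcomp Require Import all_boot all_order all_algebra.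
From mathcomp Require Import all_classical all_reals all_analysis.
From mathcomp Require Import ring lra.

Set Implicit Arguments.
Unset Strict Implicit.
Unset Printing Implicit Defensive.
Import Order.TTheory GRing.Theory Num.Theory numFieldNormedType.Exports.
Local Open Scope classical_set_scope.
Local Open Scope ring_scope.

(** A slice regular f is the sum of an everywhere convergent series
    sum_n q^n a_n, hence real smooth on all of H. On one slice the coefficients
    come from a discrete Cauchy formula: Riemann sums over N-th roots of unity
    replace the contour integral, and for f of class C^1 the mean over the circle
    of w f'(z + t (w - z)) tends to 0 because the increments of f around a closed
    polygon add up to 0. By uniqueness of the coefficients on the real axis, all
    slices and radii give the same series, which can be differentiated termwise
    in arbitrary directions.

    Put P = (f + I f I) / 2, the part of f that anticommutes with I; on the slice
    P = G J. Since the Cauchy-Riemann equations hold for f and g and I P I = P,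
    dbar^k (f g) = P (d/dx)^k g for k > 0, while (d/dy)^k g = I^k (d/dx)^k g. So
    dbar^k (f g) vanishes at q if and only if G or (d/dy)^k g does. *)

(** Completeness is what turns absolute convergence of a quaternionic series into convergence. *)
HB.instance Definition _ (R : realType) := Complete.copy (quat R) 'rV[R]_4.

(** * Norm estimates for quaternions *)

Section QuaternionNorm.
Variable R : realType.
Implicit Types p q r : quat R.

Lemma quat_coordD p q i : (p + q) 0 i = p 0 i + q 0 i.
Proof. by rewrite mxE. Qed.
Lemma quat_coordN q i : (- q) 0 i = - q 0 i.
Proof. by rewrite mxE. Qed.
Lemma quat_coordZ (a : R) q i : (a *: q) 0 i = a * q 0 i.
Proof. by rewrite mxE. Qed.
Lemma quat_coord0 i : (0 : quat R) 0 i = 0.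
Proof. by rewrite mxE. Qed.
Definition quat_coordE := (quat_coordD, quat_coordN, quat_coordZ, quat_coord0).

Lemma qnorm_coord q (i : 'I_4) : `|q ord0 i| <= `|q|.
Proof.
rewrite [leRHS]/Num.Def.normr/= mx_normrE.
exact: (le_bigmax _ (fun ij => `|q ij.1 ij.2|) (ord0, i)).
Qed.

Lemma qnorm_le q (c : R) : 0 <= c ->
  `|qre q| <= c -> `|qi q| <= c -> `|qj q| <= c -> `|qk q| <= c -> `|q| <= c.
Proof.
move=> c0 h0 h1 h2 h3; rewrite [leLHS]/Num.Def.normr/= mx_normrE.
apply: bigmax_le => // -[i j] _ /=; rewrite (ord1 i) -[j]inord_val.
by case: j => [[|[|[|[|j]]]] Hj].
Qed.

Lemma qnorm_coords q :
  [/\ `|qre q| <= `|q|, `|qi q| <= `|q|, `|qj q| <= `|q| & `|qk q| <= `|q|].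
Proof. by split; apply: qnorm_coord. Qed.

(** Each coordinate of a product is a signed sum of four products of coordinates, whence the factor
    4. *)
Lemma qnormM p q : `|p * q| <= 4 * (`|p| * `|q|).
Proof.
have [a0 a1 a2 a3] := qnorm_coords p; have [b0 b1 b2 b3] := qnorm_coords q.
have h (a b : R) : `|a| <= `|p| -> `|b| <= `|q| -> `|a * b| <= `|p| * `|q|.
  by move=> ? ?; rewrite normrM ler_pM.
apply: qnorm_le; rewrite ?quatME ?mkquatE; first by rewrite !mulr_ge0.
all: rewrite (_ : 4 * (`|p| * `|q|) =
  `|p| * `|q| + `|p| * `|q| + `|p| * `|q| + `|p| * `|q|); [|ring].
all: do ![apply: le_trans (ler_normB _ _) _; apply: lerD; last exact: h |
          apply: le_trans (ler_normD _ _) _; apply: lerD; last exact: h].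
all: exact: h.
Qed.

Lemma qnorm1 : `|1 : quat R| = 1.
Proof.
apply/eqP; rewrite eq_le; apply/andP; split.
  by apply: qnorm_le => //; rewrite quat1E mkquatE ?normr1 ?normr0.
by have [+ _ _ _] := qnorm_coords 1; rewrite {1}quat1E mkquatE normr1.
Qed.

(* The sup norm is not submultiplicative, but four times it is. *)
Definition qn q : R := 4 * `|q|.

Lemma qn_ge0 q : 0 <= qn q. Proof. by rewrite mulr_ge0. Qed.
Lemma qn0 : qn 0 = 0. Proof. by rewrite /qn normr0 mulr0. Qed.
Lemma qn1 : qn 1 = 4. Proof. by rewrite /qn qnorm1 mulr1. Qed.
Lemma qnD p q : qn (p + q) <= qn p + qn q.
Proof. by rewrite /qn -mulrDr ler_wpM2l// ler_normD. Qed.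
Lemma qnM p q : qn (p * q) <= qn p * qn q.
Proof.
by rewrite /qn (_ : 4 * _ * _ = 4 * (4 * (`|p| * `|q|))); [|ring];
  rewrite ler_wpM2l// qnormM.
Qed.
Lemma qn_sum (I : Type) (s : seq I) (F : I -> quat R) :
  qn (\sum_(i <- s) F i) <= \sum_(i <- s) qn (F i).
Proof. by rewrite /qn -mulr_sumr ler_wpM2l// ler_norm_sum. Qed.
Lemma qnX q n : qn (q ^+ n) <= 4 * qn q ^+ n.
Proof.
elim: n => [|n IH]; first by rewrite !expr0 qn1 mulr1.
rewrite !exprS mulrCA; apply: le_trans (qnM _ _) _.
by rewrite ler_wpM2l// qn_ge0.
Qed.
Lemma norm_le_qn q : `|q| <= qn q.
Proof. by rewrite /qn ler_peMl// ler1n. Qed.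

(** The inverse is the conjugate divided by the squared Euclidean norm [qdot q q], which dominates
    the square of the sup norm. *)
Lemma qnV q : q != 0 -> `|q^-1| <= `|q|^-1.
Proof.
move=> q0; have n0 : 0 < `|q| by rewrite normr_gt0.
have d0 : 0 < qdot q q.
  by rewrite lt_def qdot_eq0 q0 /qdot; nra.
have dq : `|q| ^+ 2 <= qdot q q.
  have sd (c : R) : c ^+ 2 <= qdot q q -> `|c| <= Num.sqrt (qdot q q).
    by move=> h; rewrite -sqrtr_sqr ler_wsqrtr.
  suff : `|q| <= Num.sqrt (qdot q q).
    by rewrite -(ler_pXn2r (n := 2)) ?nnegrE ?sqrtr_ge0// sqr_sqrtr// ltW.
  by apply: qnorm_le; rewrite ?sqrtr_ge0//; apply: sd; rewrite /qdot; nra.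
have -> : q^-1 = (qdot q q)^-1 *: qconj q by [].
rewrite normrZ gtr0_norm ?invr_gt0//.
have cq : `|qconj q| <= `|q|.
  have [? ? ? ?] := qnorm_coords q.
  by apply: qnorm_le; rewrite ?mkquatE ?normrN.
rewrite ler_pdivrMl// (le_trans cq)//.
by rewrite ler_pdivlMr// -expr2.
Qed.

Lemma quat_mul_eq0 p q : p * q = 0 -> p = 0 \/ q = 0.
Proof.
move=> h; have [->|p0] := eqVneq p 0; [by left|right].
have : p^-1 * (p * q) = q by rewrite mulrA mulVr ?mul1r// unitrE; apply/eqP;
  exact: qmulqV.
by rewrite h mulr0.
Qed.

End QuaternionNorm.

(** Decides identities between real linear combinations of quaternions, with quaternion products
    treated as atoms. *)
Ltac qlinear := apply/rowP => ?; rewrite !quat_coordE; ring.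

(** * Continuity and differentiation of the quaternion product *)

Section Product.
Variable R : realType.
Implicit Types (f g : quat R -> quat R) (p q v : quat R).

(** A named copy of the product, to carry the bilinear structure that [differentiable_bilin] and
    [diff_bilin] expect. *)
Definition qmulf : quat R -> quat R -> quat R := *%R.

Lemma qmulf_is_bilinear :
  bilinear_for (GRing.Scale.Law.clone _ _ ( *:%R ) _)
    (GRing.Scale.Law.clone _ _ ( *:%R ) _) qmulf.
Proof.
split=> [u a x y|u a x y] /=; rewrite /qmulf.
  by rewrite mulrDl -qscalerAl.
by rewrite mulrDr -qscalerAr.
Qed.

HB.instance Definition _ :=
  bilinear_isBilinear.Build R (quat R) (quat R) (quat R) _ _ qmulf
    qmulf_is_bilinear.

Lemma qmul_continuous : continuous (fun p : quat R * quat R => qmulf p.1 p.2).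
Proof.
move=> [a b]; apply/cvgrPdist_lt => /= e e0.
(* With d <= 1, the two terms of the difference add up to at most 4 d (|a| + |b| + 1); the 2 in
   place of 1 leaves 4 d of room for strictness. *)
pose d := Num.min 1 (e / (4 * (`|a| + `|b| + 2))).
have D : 0 < 4 * (`|a| + `|b| + 2) by rewrite mulr_gt0// ltr_wpDl// addr_ge0.
have d0 : 0 < d by rewrite lt_min ltr01 divr_gt0.
near=> z.
have [z1 z2] : `|a - z.1| < d /\ `|b - z.2| < d.
  have : `|(a, b) - z| < d by near: z; apply: cvgr_dist_lt.
  by rewrite prod_normE /= gt_max => /andP[].
have -> : qmulf a b - qmulf z.1 z.2 = (a - z.1) * b + z.1 * (b - z.2).
  by rewrite /qmulf !(mulrBr, mulrBl) addrA subrK.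
have dd : d * (4 * (`|a| + `|b| + 2)) <= e.
  by rewrite -ler_pdivlMr// ge_min lexx orbT.
have d1 : d <= 1 by rewrite ge_min lexx.
have z1a : `|z.1| <= `|a| + 1.
  rewrite -[z.1](subKr a); apply: le_trans (ler_normB _ _) _.
  by rewrite lerD2l (le_trans (ltW z1)).
apply: le_lt_trans (ler_normD _ _) _.
have := qnormM (a - z.1) b; have := qnormM z.1 (b - z.2).
have ? := normr_ge0 a; have ? := normr_ge0 b; have ? := normr_ge0 z.1.
have : `|a - z.1| * `|b| <= d * `|b| by rewrite ler_wpM2r// ltW.
have : `|z.1| * `|b - z.2| <= (`|a| + 1) * d by rewrite ler_pM// ltW.
move: dd; rewrite (_ : d * _ =
  4 * (d * `|b|) + 4 * ((`|a| + 1) * d) + 4 * d); last by ring.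
lra.
Unshelve. all: by end_near. Qed.

Lemma differentiable_qmul f g q : differentiable f q -> differentiable g q ->
  differentiable (f \* g) q.
Proof.
move=> df dg.
have -> : f \* g =
  (fun p : quat R * quat R => qmulf p.1 p.2) \o (fun y => (f y, g y)) by [].
apply: differentiable_comp; first exact: differentiable_pair.
exact: differentiable_bilin qmul_continuous.
Qed.

Lemma derive_qmul f g q v : differentiable f q -> differentiable g q ->
  'D_v (f \* g) q = 'D_v f q * g q + f q * 'D_v g q.
Proof.
move=> df dg; rewrite deriveE; last exact: differentiable_qmul.
pose F y := (f y, g y); pose B (p : quat R * quat R) := qmulf p.1 p.2.
have dF : differentiable F q by exact: differentiable_pair.
have dB : differentiable B (F q) by exact: differentiable_bilin qmul_continuous.
have := congr1 (fun h => h v) (diff_comp dF dB).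
rewrite /= (_ : B \o F = f \* g)// => ->.
have dBE h : 'd B (F q) h = f q * h.2 + h.1 * g q.
  exact: (congr1 (fun d => d h) (diff_bilin (F q) qmul_continuous)).
rewrite dBE.
have dFv : 'd F q v = ('d f q v, 'd g q v).
  exact: (congr1 (fun h => h v) (diff_pair df dg)).
rewrite dFv /=.
by rewrite !deriveE// addrC.
Qed.

Lemma of_classW k f : of_class k.+1 f -> of_class k f.
Proof.
elim: k f => [|k IH] f [df Df].
  by move=> x; exact: differentiable_continuous.
by split=> // v; apply: IH; apply: Df.
Qed.

Lemma of_class_add k f g : of_class k f -> of_class k g -> of_class k (f \+ g).
Proof.
elim: k f g => [|k IH] f g; first by move=> cf cg x; exact: continuousD (cf x) (cg x).
move=> [df Df] [dg Dg]; split=> [x|v]; first exact: differentiableD.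
have -> : 'D_v (f \+ g) = 'D_v f \+ 'D_v g.
  by apply/funext => x; rewrite deriveD//; exact: diff_derivable.
by apply: IH; [exact: Df|exact: Dg].
Qed.

Lemma of_class_qmul k f g : of_class k f -> of_class k g -> of_class k (f \* g).
Proof.
elim: k f g => [|k IH] f g.
  move=> cf cg x.
  apply: (@continuous_comp _ _ _ (fun y => (f y, g y))
    (fun p : quat R * quat R => qmulf p.1 p.2)).
    exact: cvg_pair (cf x) (cg x).
  exact: qmul_continuous.
move=> cf cg; have [df Df] := cf; have [dg Dg] := cg.
split=> [x|v]; first exact: differentiable_qmul.
have -> : 'D_v (f \* g) = ('D_v f \* g) \+ (f \* 'D_v g).
  by apply/funext => x; rewrite derive_qmul.
by apply: of_class_add; apply: IH;
  [exact: Df|exact: of_classW|exact: of_classW|exact: Dg].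
Qed.

End Product.

(** * Index set for the Leibniz rule *)

Section Splits.
Variable T : Type.

(** These pairs index the Leibniz sum for a product whose first factor is linear: at most one
    direction can fall on that factor, and the others go to the second factor. *)
Fixpoint splits (vs : seq T) : seq (T * seq T) :=
  if vs is v :: vs' then
    (v, vs') :: [seq (w.1, v :: w.2) | w <- splits vs']
  else [::].

Lemma size_splits vs : size (splits vs) = size vs.
Proof. by elim: vs => //= v vs IH; rewrite size_map IH. Qed.

End Splits.

Lemma splitsP (T : eqType) (vs : seq T) w :
  w \in splits vs -> perm_eq (w.1 :: w.2) vs.
Proof.
elim: vs w => //= v vs IH w; rewrite inE => /predU1P[-> //|].
case/mapP => w' /IH + -> /=.
rewrite -(perm_cons v) => h; apply: perm_trans h.
by rewrite -[X in perm_eq X _]/([:: w'.1] ++ v :: w'.2) perm_catC /= -cat1s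
  -[X in perm_eq _ X]cat1s perm_cat2l -[X in perm_eq _ X]cat1s perm_catC.
Qed.

(** * Iterated directional derivatives of noncommutative powers *)

Section NoncommutativePowers.
Variable R : realType.
Implicit Types (q h v : quat R) (vs : seq (quat R)).

(* The iterated derivative of q |-> q ^+ n along the directions vs,
   by the Leibniz rule for q * q ^+ n. *)
Fixpoint dpow n vs q : quat R :=
  if n is n'.+1 then
    q * dpow n' vs q + \sum_(w <- splits vs) w.1 * dpow n' w.2 q
  else (vs == [::])%:R.

Lemma dpow_nil n q : dpow n [::] q = q ^+ n.
Proof. by elim: n => //= n ->; rewrite big_nil addr0 exprS. Qed.

Definition vnorm vs : R := \prod_(v <- vs) qn v.

Lemma vnorm_ge0 vs : 0 <= vnorm vs.
Proof. by apply: prodr_ge0 => v _; exact: qn_ge0. Qed.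

Lemma vnorm_splits vs w : w \in splits vs -> qn w.1 * vnorm w.2 = vnorm vs.
Proof.
by move=> /splitsP e; rewrite /vnorm -(perm_big _ e) big_cons.
Qed.

Lemma size_split vs w : w \in splits vs -> (size w.2).+1 = size vs.
Proof. by move=> /splitsP /perm_size <-. Qed.

Lemma sum_splits_le vs (F : quat R * seq (quat R) -> quat R) (c : R) :
  (forall w, w \in splits vs -> qn (F w) <= c) ->
  qn (\sum_(w <- splits vs) F w) <= (size vs)%:R * c.
Proof.
move=> h; apply: le_trans (qn_sum _ _) _.
apply: (@le_trans _ _ (\sum_(w <- splits vs) c)).
  by rewrite big_seq [leRHS]big_seq; apply: ler_sum => w /h.
by rewrite big_const_seq count_predT size_splits iter_addr_0 mulr_natl.
Qed.

(** Each factor of the power contributes qn q when it is left alone and one unit for each direction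
    that may fall on it; the leading 4 is [qn 1]. *)
Lemma dpow_bound n vs q :
  qn (dpow n vs q) <= 4 * vnorm vs * (qn q + (size vs)%:R) ^+ n.
Proof.
have Q0 := qn_ge0 q.
elim: n vs => [|n IH] vs /=.
  rewrite expr0 mulr1; have [->|_] /= := eqVneq.
    by rewrite qn1 /vnorm big_nil mulr1.
  by rewrite qn0 mulr_ge0// vnorm_ge0.
apply: le_trans (qnD _ _) _; set X := qn q + _.
rewrite exprS (_ : _ * (X * _) = qn q * (4 * vnorm vs * X ^+ n) +
  (size vs)%:R * (4 * vnorm vs * X ^+ n)); last by rewrite /X; ring.
apply: lerD.
  by apply: le_trans (qnM _ _) _; rewrite ler_wpM2l.
apply: sum_splits_le => w wvs; apply: le_trans (qnM _ _) _.
apply: le_trans (ler_wpM2l (qn_ge0 _) (IH _)) _.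
rewrite -(vnorm_splits wvs) (_ : _ * (4 * vnorm w.2 * _) =
  4 * (qn w.1 * vnorm w.2) * (qn q + (size w.2)%:R) ^+ n); last by ring.
apply: ler_wpM2l; first by rewrite !mulr_ge0// ?qn_ge0// vnorm_ge0.
rewrite lerXn2r// ?nnegrE ?addr_ge0// /X -(size_split wvs).
by rewrite lerD2l ler_nat.
Qed.

(** The first direction is the one that becomes the argument of the differential, so linearity is
    recorded there. *)
Lemma dpow_linear n vs q (a : R) h1 h2 :
  dpow n (a *: h1 + h2 :: vs) q =
  a *: dpow n (h1 :: vs) q + dpow n (h2 :: vs) q.
Proof.
elim: n vs => [|n IH] vs /=; first by rewrite scaler0 addr0.
rewrite !big_cons !big_map IH /=; under eq_bigr do rewrite IH.
rewrite !mulrDr !mulrDl -!qscalerAl -!qscalerAr.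
under eq_bigr do rewrite mulrDr -qscalerAr.
by rewrite big_split -scaler_sumr /=; qlinear.
Qed.

Definition dpow_rem n vs q h :=
  dpow n vs (q + h) - dpow n vs q - dpow n (h :: vs) q.

(** A first order Taylor estimate proved by algebra alone. It is explicit in n, so it can be summed
    against the coefficients and then justifies termwise differentiation. *)
Lemma dpow_rem_bound n vs q h : qn h <= 1 ->
  qn (dpow_rem n vs q h) <=
  4 * vnorm vs * qn h ^+ 2 * (qn q + (size vs)%:R + 3) ^+ n.
Proof.
move=> h1; have Q0 := qn_ge0 q; have H0 := qn_ge0 h.
elim: n vs => [|n IH] vs.
  by rewrite /dpow_rem /= subrr subr0 qn0 !mulr_ge0// vnorm_ge0.
set X := qn q + (size vs)%:R + 3.
have V0 := vnorm_ge0 vs.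
have X0 : 0 <= X by rewrite /X !addr_ge0.
have Xn0 : 0 <= X ^+ n by rewrite exprn_ge0.
(* Expanding the factor q + h gives a recursion for the remainder. The two terms with factor h cost
   at most B each, which the constant 3 in X absorbs. *)
have -> : dpow_rem n.+1 vs q h = q * dpow_rem n vs q h
  + h * (dpow_rem n vs q h + dpow n (h :: vs) q)
  + \sum_(w <- splits vs) w.1 * dpow_rem n w.2 q h.
  rewrite /dpow_rem /= big_cons big_map /=.
  under [X in _ = _ + X]eq_bigr do rewrite !mulrBr.
  rewrite !sumrB subrK !mulrBr mulrDl.
  set a := \sum_(w <- _) _; set b := \sum_(w <- _) _; set c := \sum_(w <- _) _.
  qlinear.
set B := 4 * vnorm vs * qn h ^+ 2 * X ^+ n.
have B0 : 0 <= B by rewrite /B !mulr_ge0.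
have IHvs : qn (dpow_rem n vs q h) <= B by exact: IH.
have Dvs : qn (dpow n (h :: vs) q) <= 4 * vnorm vs * qn h * X ^+ n.
  apply: le_trans (dpow_bound _ _ _) _.
  rewrite {1}/vnorm big_cons -/(vnorm vs) (_ : 4 * (_ * _) = 4 * vnorm vs * qn h);
    last by ring.
  apply: ler_wpM2l; first by rewrite !mulr_ge0.
  by rewrite lerXn2r ?nnegrE ?addr_ge0//= -natr1 /X; lra.
have Svs : qn (\sum_(w <- splits vs) w.1 * dpow_rem n w.2 q h) <=
    (size vs)%:R * B.
  apply: sum_splits_le => w wvs; apply: le_trans (qnM _ _) _.
  apply: le_trans (ler_wpM2l (qn_ge0 _) (IH _)) _.
  rewrite /B -(vnorm_splits wvs) [leLHS](_ : _ = 4 * (qn w.1 * vnorm w.2) *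
    qn h ^+ 2 * (qn q + (size w.2)%:R + 3) ^+ n); last by ring.
  apply: ler_wpM2l; first by rewrite !mulr_ge0 ?qn_ge0 ?vnorm_ge0.
  rewrite lerXn2r ?nnegrE ?addr_ge0// /X -(size_split wvs).
  by rewrite lerD2r lerD2l ler_nat.
apply: le_trans (qnD _ _) _; apply: le_trans (lerD (qnD _ _) (lexx _)) _.
have h2 : qn h * B <= 1 * B by rewrite ler_wpM2r.
have := ler_wpM2l Q0 IHvs; have := qnM q (dpow_rem n vs q h).
have := ler_wpM2l H0 (lerD IHvs Dvs).
have := ler_wpM2l H0 (qnD (dpow_rem n vs q h) (dpow n (h :: vs) q)).
have := qnM h (dpow_rem n vs q h + dpow n (h :: vs) q).
have -> : 4 * vnorm vs * qn h ^+ 2 * X ^+ n.+1 =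
  qn q * B + (size vs)%:R * B + B + B + B by rewrite /B /X [_ ^+ n.+1]exprS; ring.
have -> : qn h * (B + 4 * vnorm vs * qn h * X ^+ n) = qn h * B + B.
  by rewrite /B; ring.
lra.
Qed.

(** A direction that commutes with the point and with the other directions can be pulled out to the
    left. On a slice this reduces every derivative to the one along 1, which is the source of the
    Cauchy-Riemann equations. *)
Lemma dpow_commute n vs q v : GRing.comm v q ->
  (forall w, w \in vs -> GRing.comm v w) ->
  dpow n (v :: vs) q = v * dpow n (1 :: vs) q.
Proof.
move=> vq; elim: n vs => [|n IH] vs hvs /=; first by rewrite mulr0.
rewrite !big_cons !big_map /= mul1r IH// !mulrDr mulrA -vq -mulrA.
congr (_ + (_ + _)); rewrite mulr_sumr big_seq [RHS]big_seq.
apply: eq_bigr => w /splitsP/perm_mem e.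
rewrite IH; last by move=> u uw; apply: hvs; rewrite -e inE uw orbT.
by rewrite mulrA -hvs -?mulrA// -e inE eqxx.
Qed.

End NoncommutativePowers.

(** * Series dominated by a geometric series of ratio 1/2 *)

Section GeometricBound.
Variable R : realType.

Lemma sum_half_le m : \sum_(0 <= n < m) (2^-1 : R) ^+ n <= 2.
Proof.
have -> : \sum_(0 <= n < m) (2^-1 : R) ^+ n = 2 - 2 * 2^-1 ^+ m.
  elim: m => [|m IH]; first by rewrite big_nil expr0; ring.
  by rewrite big_nat_recr//= IH exprS; field.
by rewrite gerBl mulr_ge0// exprn_ge0.
Qed.

Lemma series_half_cvg (u : (quat R)^nat) (c : R) :
  (forall n, `|u n| <= c * 2^-1 ^+ n) -> cvgn (series u).
Proof.
move=> uc; apply: normed_cvg.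
have c0 : 0 <= c by have := uc 0%N; rewrite expr0 mulr1; apply: le_trans.
apply: (@series_le_cvg _ (fun n => `|u n|) (fun n => c * 2^-1 ^+ n) _ _ uc).
- by move=> n; exact: normr_ge0.
- by move=> n; rewrite mulr_ge0// exprn_ge0.
- apply: (@is_cvg_geometric_series R c 2^-1).
  by rewrite ger0_norm// invf_lt1// ltr1n.
Qed.

Lemma series_half_bound (u : (quat R)^nat) (c : R) m :
  (forall n, `|u n| <= c * 2^-1 ^+ n) -> `|series u m| <= 2 * c.
Proof.
move=> uc.
have c0 : 0 <= c by have := uc 0%N; rewrite expr0 mulr1; apply: le_trans.
rewrite /series/=; apply: le_trans (ler_norm_sum _ _ _) _.
apply: le_trans (ler_sum _ (fun i _ => uc i)) _.
by rewrite -mulr_sumr mulrC ler_wpM2r// sum_half_le.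
Qed.

Lemma lim_series_half (u : (quat R)^nat) (c : R) :
  (forall n, `|u n| <= c * 2^-1 ^+ n) -> `|limn (series u)| <= 2 * c.
Proof.
move=> uc; have cu := series_half_cvg uc.
rewrite -lim_norm//; apply: limr_le; first exact: is_cvg_norm.
by near=> m; exact: series_half_bound.
Unshelve. all: by end_near. Qed.

End GeometricBound.

(** * Entire power series with coefficients on the right *)

Section PowerSeries.
Variables (R : realType) (a : (quat R)^nat).
Implicit Types (q h v : quat R) (vs : seq (quat R)).

(** Infinite radius of convergence, put as a boundedness condition: applied to 2 X, it gives a
    geometric bound of ratio 1/2. *)
Definition entire :=
  forall X : R, 0 <= X -> exists M, forall n, qn (a n) * X ^+ n <= M.

(** The termwise iterated derivative along vs of the sum of the q^n a_n; the empty list gives the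
    sum itself. *)
Definition pser vs q : quat R := limn (series (fun n => dpow n vs q * a n)).

Hypothesis entire_a : entire.

(** Since c depends on X but not on u, the bounds derived from it are uniform in the increment h. *)
Lemma entire_half (X : R) : 0 <= X -> exists2 c, 0 <= c &
  forall (u : (quat R)^nat) B, 0 <= B -> (forall n, qn (u n) <= B * X ^+ n) ->
  forall n, `|u n * a n| <= B * c * 2^-1 ^+ n.
Proof.
move=> X0; have [M aM] := entire_a (mulr_ge0 (ler0n _ 2) X0).
have M0 : 0 <= M by have := aM 0%N; apply: le_trans; rewrite mulr1 qn_ge0.
exists M => // u B B0 uB n.
apply: le_trans (norm_le_qn _) _; apply: le_trans (qnM _ _) _.
apply: (@le_trans _ _ (B * X ^+ n * qn (a n))); first by rewrite ler_wpM2r ?qn_ge0.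
rewrite -!mulrA ler_wpM2l// exprVn ler_pdivlMr ?exprn_gt0//.
by apply: le_trans (aM n); rewrite exprMn le_eqVlt; apply/orP; left; apply/eqP; ring.
Qed.

Lemma pser_term vs q : exists c, forall n,
  `|dpow n vs q * a n| <= c * 2^-1 ^+ n.
Proof.
have [c c0 hc] := entire_half (addr_ge0 (qn_ge0 q) (ler0n _ (size vs))).
exists (4 * vnorm vs * c); apply: hc.
  by rewrite mulr_ge0// vnorm_ge0.
by move=> n; exact: dpow_bound.
Qed.

Lemma pser_cvg vs q : series (fun n => dpow n vs q * a n) @ \oo --> pser vs q.
Proof. by have [c hc] := pser_term vs q; exact: series_half_cvg hc. Qed.

Lemma pser_linear vs q (b : R) h1 h2 :
  pser (b *: h1 + h2 :: vs) q = b *: pser (h1 :: vs) q + pser (h2 :: vs) q.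
Proof.
apply: cvg_lim => //.
have -> : series (fun n => dpow n (b *: h1 + h2 :: vs) q * a n) =
  (fun m => b *: series (fun n => dpow n (h1 :: vs) q * a n) m
  + series (fun n => dpow n (h2 :: vs) q * a n) m).
  apply/funext => m; rewrite /series /= scaler_sumr -big_split /=.
  by apply: eq_bigr => n _; rewrite dpow_linear mulrDl -qscalerAl.
by apply: cvgD; [apply: cvgZr; exact: pser_cvg|exact: pser_cvg].
Qed.

Lemma pser_bound vs q : exists2 C, 0 <= C &
  forall h, `|pser (h :: vs) q| <= C * `|h|.
Proof.
have [c c0 hc] := entire_half (addr_ge0 (qn_ge0 q) (ler0n _ (size vs).+1)).
exists (2 * (4 * (4 * vnorm vs) * c)).
  by rewrite !mulr_ge0// vnorm_ge0.
move=> h.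
rewrite (_ : _ * `|h| = 2 * (4 * (qn h * vnorm vs) * c)); last by rewrite /qn; ring.
apply: lim_series_half; apply: hc.
  by rewrite !mulr_ge0// ?qn_ge0// vnorm_ge0.
move=> n; have := dpow_bound n (h :: vs) q.
by rewrite {1}/vnorm big_cons.
Qed.

Lemma pser_rem vs q : exists2 C, 0 <= C & forall h, qn h <= 1 ->
  `|pser vs (q + h) - pser vs q - pser (h :: vs) q| <= C * qn h ^+ 2.
Proof.
have X0 : 0 <= qn q + (size vs)%:R + 3 by rewrite !addr_ge0// qn_ge0.
have [c c0 hc] := entire_half X0.
exists (2 * (4 * vnorm vs * c)); first by rewrite !mulr_ge0// vnorm_ge0.
move=> h h1.
rewrite (_ : _ * _ ^+ 2 = 2 * (4 * vnorm vs * qn h ^+ 2 * c)); last by ring.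
have -> : pser vs (q + h) - pser vs q - pser (h :: vs) q =
  limn (series (fun n => dpow_rem n vs q h * a n)).
  apply/esym/cvg_lim => //.
  have -> : series (fun n => dpow_rem n vs q h * a n) = (fun m =>
    series (fun n => dpow n vs (q + h) * a n) m
    - series (fun n => dpow n vs q * a n) m
    - series (fun n => dpow n (h :: vs) q * a n) m).
    apply/funext => m; rewrite /series /= -!sumrB.
    by apply: eq_bigr => n _; rewrite /dpow_rem !mulrBl.
  by apply: cvgB; [apply: cvgB; exact: pser_cvg|exact: pser_cvg].
apply: lim_series_half; apply: hc.
  by rewrite !mulr_ge0// ?exprn_ge0 ?qn_ge0// vnorm_ge0.
by move=> n; exact: dpow_rem_bound.
Qed.

(** The map h |-> [pser (h :: vs) q] is linear and bounded, and it leaves a quadratic remainder, so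
    it is the differential. *)
Lemma pser_diff vs q : differentiable (pser vs) q /\
  forall v, 'D_v (pser vs) q = pser (v :: vs) q.
Proof.
pose L h := pser (h :: vs) q.
have linL : linear L by move=> b h1 h2; exact: pser_linear.
pose LM := GRing.isLinear.Build _ _ _ _ _ linL.
pose LL : {linear _ -> _} := HB.pack L LM.
have cL : continuous LL.
  apply: bounded_linear_continuous; apply/linear_boundedP.
  have [C C0 hC] := pser_bound vs q.
  exists C; split=> [|r Cr x]; first exact: ger0_real.
  by apply: le_trans (hC x) _; rewrite ler_wpM2r// ltW.
have oL : pser vs \o shift q = cst (pser vs q) + LL +o_ 0 id.
  apply/eqaddoP => _/posnumP[e].
  have [C C0 hC] := pser_rem vs q.
  (* The bound 1/4 ensures qn h <= 1; the other one gives 16 C |h| <= e, where 16 comes from the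
     square of qn h. *)
  pose d := Num.min (4^-1) (e%:num / (16 * (C + 1))).
  have C1 : 0 < 16 * (C + 1) by rewrite mulr_gt0// ltr_wpDl.
  have d0 : 0 < d by rewrite lt_min invr_gt0 ltr0n divr_gt0.
  near=> h.
  have hd : `|h| <= d.
    by near: h; exact: (@nbhs0_le R (quat R)).
  have h1 : qn h <= 1.
    by rewrite /qn -ler_pdivlMl// mulr1; apply: le_trans hd _.
  have -> : (pser vs \o shift q - (cst (pser vs q) + LL)) h =
    pser vs (q + h) - pser vs q - pser (h :: vs) q.
    by rewrite -[LHS]/(pser vs (h + q) - (pser vs q + L h)) opprD addrA [h + q]addrC.
  apply: le_trans (hC h h1) _.
  have : 16 * (C + 1) * d <= e%:num.
    by rewrite mulrC -ler_pdivlMr// /d ge_min lexx orbT.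
  have := ler_wpM2l (ltW C1) hd; have := normr_ge0 h => hh le1 le2.
  rewrite /qn (_ : _ * _ ^+ 2 = 16 * C * `|h| * `|h|); last by ring.
  by rewrite ler_wpM2r//; lra.
have dE : 'd (pser vs) q = LL :> (_ -> _) by exact: diff_unique.
have df : differentiable (pser vs) q.
  by apply/diff_locallyP; rewrite dE.
by split=> // v; rewrite deriveE// dE.
Unshelve. all: by end_near. Qed.

Lemma pser_of_class k vs : of_class k (pser vs).
Proof.
elim: k vs => [|k IH] vs.
  by move=> q; apply: differentiable_continuous; have [] := pser_diff vs q.
split=> [q|v]; first by have [] := pser_diff vs q.
have -> : 'D_v (pser vs) = pser (v :: vs).
  by apply/funext => q; have [_ ->] := pser_diff vs q.
exact: IH.
Qed.

Lemma pser_commute vs q v : GRing.comm v q ->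
  (forall w, w \in vs -> GRing.comm v w) ->
  pser (v :: vs) q = v * pser (1 :: vs) q.
Proof.
move=> vq hvs; apply: cvg_lim => //.
have -> : series (fun n => dpow n (v :: vs) q * a n) =
  (fun m => qmulf v (series (fun n => dpow n (1 :: vs) q * a n) m)).
  apply/funext => m; rewrite /series /= /qmulf mulr_sumr.
  by apply: eq_bigr => n _; rewrite dpow_commute// mulrA.
exact: (continuous2_cvg _ (@qmul_continuous R (v, pser (1 :: vs) q))
  (cvg_cst v) (@pser_cvg (1 :: vs) q)).
Qed.

End PowerSeries.

(** * Compact balls, uniform continuity and the mean value inequality *)

Section CompactBall.
Variable R : realType.
Implicit Types (p q h : quat R) (F : quat R -> quat R).

Lemma qball_compact (r : R) : compact [set q : quat R | `|q| <= r].
Proof.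
apply: (@bounded_closed_compact R 4).
  exists r; split=> [|x rx q /= qr]; first exact: num_real.
  exact: le_trans qr (ltW rx).
have -> : [set q : quat R | `|q| <= r] = Num.norm @^-1` [set x : R | x <= r] by [].
apply: closed_comp; last exact: closed_le.
by move=> x _; exact: norm_continuous.
Qed.

Lemma continuous_bounded F (r : R) : continuous F ->
  exists2 M, 0 <= M & forall q, `|q| <= r -> `|F q| <= M.
Proof.
move=> cF.
have : compact (F @` [set q : quat R | `|q| <= r]).
  apply: continuous_compact; last exact: qball_compact.
  exact: continuous_subspaceT.
move=> /compact_bounded [M [_ hM]].
exists (Num.max 0 (M + 1)); first by rewrite le_max lexx.
move=> q qr; apply: hM; last by exists q.
by rewrite lt_max ltrDl ltr01 orbT.
Qed.

(** Compactness in its near-covering form, for the filter of radii tending to 0 from the right,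
    makes a locally good radius good on the whole ball. Only p is confined to the ball. *)
Lemma heine_cantor F (r e : R) : continuous F -> 0 < e ->
  exists2 d, 0 < d & forall p q, `|p| <= r -> `|q - p| < d -> `|F q - F p| < e.
Proof.
move=> cF e0; have /compact_near_coveringP := @qball_compact r.
move=> /(_ R (0 : R)^'+ (fun d p => forall q, `|q - p| < d -> `|F q - F p| < e)) /=.
case=> [p pr|d /= d0 hd].
  have /cvgrPdist_lt /(_ (e / 2)) := cF p.
  move=> /(_ (divr_gt0 e0 (ltr0n _ 2))) /nbhs_ballP [d /= d0 hd].
  exists (ball p (d / 2), [set x | 0 < x < d / 2]) => /=.
    split; first by apply: nbhsx_ballx; rewrite divr_gt0.
    by near=> x; apply/andP; split=> //; near: x; apply: nbhs_right_lt; rewrite divr_gt0.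
  move=> [p' x] [/= pp' /andP[x0 xd]] q qp'.
  have dp : d / 2 < d by rewrite ltr_pdivrMr// ltr_pMr// ltr1n.
  move: pp'; rewrite -ball_normE /= => pp'.
  have h1 : `|F p - F p'| < e / 2.
    by apply: hd; rewrite -ball_normE /=; exact: lt_trans pp' dp.
  have h2 : `|F p - F q| < e / 2.
    apply: hd; rewrite -ball_normE /= -(subrKA p') [d]splitr.
    apply: le_lt_trans (ler_normD _ _) _; apply: ltrD => //.
    by rewrite distrC (lt_trans qp').
  rewrite -(subrKA (F p)) [e]splitr.
  by apply: le_lt_trans (ler_normD _ _) _; apply: ltrD => //; rewrite distrC.
have d20 : 0 < d / 2 by rewrite divr_gt0.
exists (d / 2) => // p q pr; apply: (hd (d / 2)) => //=.
by rewrite sub0r normrN gtr0_norm// ltr_pdivrMr// ltr_pMr// ltr1n.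
Unshelve. all: by end_near. Qed.

(** For the sup norm the inequality is the scalar mean value theorem on each coordinate. *)
Lemma mean_value_le (u du : R -> quat R) (C : R) :
  (forall t : R, 0 <= t <= 1 -> is_derive t (1 : R) u (du t)) ->
  (forall t : R, 0 < t < 1 -> `|du t| <= C) -> 0 <= C -> `|u 1 - u 0| <= C.
Proof.
move=> hu hC C0.
have coord (i : 'I_4) : `|(u 1 - u 0) 0 i| <= C.
  pose v (t : R) : R := u t 0 i.
  have hv (t : R) : 0 <= t <= 1 -> is_derive t (1 : R) v (du t 0 i).
    move=> /hu [dut <-]; split.
      exact: ((derivable_mxP (u : R -> 'rV[R]_4) t (1 : R)).1 dut).
    by rewrite (derive_mx (M := u : R -> 'rV[R]_4) dut) mxE.
  have [t||c c01 vE] := @MVT R v (fun t => du t 0 i) 0 1 ltr01.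
  - by rewrite in_itv/= => /andP[t0 t1]; apply: hv; rewrite !ltW.
  - apply: derivable_within_continuous => t; rewrite in_itv/= => t01.
    by have [] := hv t t01.
  move: c01; rewrite in_itv/= => c01.
  rewrite quat_coordD quat_coordN -/(v 1) -/(v 0) vE subr0 mulr1.
  exact: le_trans (qnorm_coord _ _) (hC c c01).
by apply: qnorm_le => //; exact: coord.
Qed.

Lemma is_derive_line F p h (t : R) : derivable F (p + t *: h) h ->
  is_derive t (1 : R) (fun s : R => F (p + s *: h)) ('D_h F (p + t *: h)).
Proof.
have E : (fun s : R => s^-1 *: (((fun s : R => F (p + s *: h)) \o shift t)
    (s *: (1 : R)) - F (p + t *: h))) =
  (fun s : R => s^-1 *: ((F \o shift (p + t *: h)) (s *: h) - F (p + t *: h))).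
  by apply/funext => s /=; rewrite [s *: 1]mulr1 scalerDl addrCA addrA.
by move=> dF; split; rewrite /derivable /derive E.
Qed.

End CompactBall.

(** * Slices as centralizers of imaginary units *)

Section SliceAlgebra.
Variable R : realType.
Implicit Types (I J p q h : quat R).

Lemma qunit q : q != 0 -> q \is a GRing.unit.
Proof. by move=> q0; rewrite unitrE; apply/eqP; exact: qmulqV. Qed.

Lemma qreN q : qre (- q) = - qre q. Proof. exact: quat_coordN. Qed.
Lemma qiN q : qi (- q) = - qi q. Proof. exact: quat_coordN. Qed.
Lemma qjN q : qj (- q) = - qj q. Proof. exact: quat_coordN. Qed.
Lemma qkN q : qk (- q) = - qk q. Proof. exact: quat_coordN. Qed.
Definition quatNE := (qreN, qiN, qjN, qkN).

Lemma imag_units_coords I : imag_units I ->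
  qre I = 0 /\ qi I ^+ 2 + qj I ^+ 2 + qk I ^+ 2 = 1.
Proof.
rewrite /imag_units /= expr2 quatME => h.
have := congr1 (@qre R) h; have := congr1 (@qi R) h.
have := congr1 (@qj R) h; have := congr1 (@qk R) h.
rewrite !quatNE !quat1E !mkquatE => h3 h2 h1 h0.
have [r0|r0] := eqVneq (qre I) 0; first by split=> //; rewrite r0 in h0; lra.
have e1 : qi I = 0 by apply: (mulfI r0); lra.
have e2 : qj I = 0 by apply: (mulfI r0); lra.
have e3 : qk I = 0 by apply: (mulfI r0); lra.
by rewrite e1 e2 e3 in h0; nra.
Qed.

Lemma imag_unitsP I : qre I = 0 -> qi I ^+ 2 + qj I ^+ 2 + qk I ^+ 2 = 1 ->
  imag_units I.
Proof.
move=> r0 n1; rewrite /imag_units /= expr2 quatME.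
by apply: quatP; rewrite quatNE quat1E !mkquatE ?r0 -?n1; ring.
Qed.

(** Commuting with I means that the cross product of the imaginary parts vanishes, so that of q is a
    multiple of I, by the inner product of the two. Closure of slices under products and powers then
    follows from that of centralizers. *)
Lemma sliceP I q : imag_units I -> slice I q <-> GRing.comm I q.
Proof.
move=> hI; have [r0 n1] := imag_units_coords hI; split.
  move=> [x [y ->]]; rewrite /GRing.comm mulrDr mulrDl.
  by rewrite -!qscalerAl -!qscalerAr mulr1 mul1r.
rewrite /GRing.comm !quatME => h.
have h1 := congr1 (@qi R) h; have h2 := congr1 (@qj R) h.
have h3 := congr1 (@qk R) h.
move: h1 h2 h3; rewrite !mkquatE r0 => h1 h2 h3.
have e1 : qj I * qk q = qk I * qj q by lra.
have e2 : qk I * qi q = qi I * qk q by lra.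
have e3 : qi I * qj q = qj I * qi q by lra.
exists (qre q), (qi I * qi q + qj I * qj q + qk I * qk q).
apply: quatP; rewrite !(quatDE, quatZE) quat1E !mkquatE ?r0.
- ring.
- transitivity (qi I * (qi I * qi q) + qj I * (qj I * qi q) + qk I * (qk I * qi q)).
    by rewrite -[LHS]mulr1 -n1; ring.
  by rewrite -e3 e2; ring.
- transitivity (qi I * (qi I * qj q) + qj I * (qj I * qj q) + qk I * (qk I * qj q)).
    by rewrite -[LHS]mulr1 -n1; ring.
  by rewrite e3 -e1; ring.
- transitivity (qi I * (qi I * qk q) + qj I * (qj I * qk q) + qk I * (qk I * qk q)).
    by rewrite -[LHS]mulr1 -n1; ring.
  by rewrite -e2 e1; ring.
Qed.

Lemma slice_mulC I p q : slice I p -> slice I q -> p * q = q * p.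
Proof.
move=> [x [y ->]] [x' [y' ->]].
rewrite !mulrDr !mulrDl -!qscalerAl -!qscalerAr ?mul1r ?mulr1.
by rewrite !scalerA; qlinear.
Qed.

Lemma slice_real I (x : R) : slice I (x%:A).
Proof. by exists x, 0; rewrite scale0r addr0. Qed.

Lemma slice_unit I : slice I I.
Proof. by exists 0, 1; rewrite scale0r add0r scale1r. Qed.

Lemma slice0 I : slice I 0.
Proof. by exists 0, 0; rewrite !scale0r addr0. Qed.

Lemma slice1 I : slice I 1.
Proof. by rewrite -[1]scale1r; exact: slice_real. Qed.

Lemma sliceD I p q : slice I p -> slice I q -> slice I (p + q).
Proof.
move=> [x [y ->]] [x' [y' ->]]; exists (x + x'), (y + y').
by qlinear.
Qed.

Lemma sliceZ I (a : R) q : slice I q -> slice I (a *: q).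
Proof.
move=> [x [y ->]]; exists (a * x), (a * y).
by rewrite scalerDr !scalerA.
Qed.

Lemma sliceN I q : slice I q -> slice I (- q).
Proof. by rewrite -scaleN1r; exact: sliceZ. Qed.

Lemma sliceB I p q : slice I p -> slice I q -> slice I (p - q).
Proof. by move=> hp hq; apply: sliceD => //; exact: sliceN. Qed.

Lemma sliceM I p q : imag_units I -> slice I p -> slice I q -> slice I (p * q).
Proof.
by move=> hI /(sliceP _ hI) hp /(sliceP _ hI) hq; apply/(sliceP _ hI); exact: commrM.
Qed.

Lemma sliceX I q n : imag_units I -> slice I q -> slice I (q ^+ n).
Proof.
by move=> hI /(sliceP _ hI) hq; apply/(sliceP _ hI); exact: commrX.
Qed.

Lemma slice_exists q : exists2 I, imag_units I & slice I q.
Proof.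
have [h|h] := eqVneq (qi q ^+ 2 + qj q ^+ 2 + qk q ^+ 2) 0.
  exists (mkquat 0 1 0 0); first by apply: imag_unitsP; rewrite !mkquatE; ring.
  exists (qre q), 0; rewrite scale0r addr0.
  by apply: quatP; rewrite !quatZE quat1E !mkquatE; nra.
pose s := Num.sqrt (qi q ^+ 2 + qj q ^+ 2 + qk q ^+ 2).
have n0 : 0 <= qi q ^+ 2 + qj q ^+ 2 + qk q ^+ 2 by nra.
have s2 : s ^+ 2 = qi q ^+ 2 + qj q ^+ 2 + qk q ^+ 2 by rewrite sqr_sqrtr.
have s0 : s != 0 by apply: contra_neq h => s0; rewrite -s2 s0 expr0n.
exists (mkquat 0 (qi q / s) (qj q / s) (qk q / s)).
  apply: imag_unitsP; rewrite !mkquatE// !expr_div_n -!mulrDl -s2 divff//.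
  by rewrite expf_eq0.
exists (qre q), s; apply: quatP;
  rewrite !(quatDE, quatZE) quat1E !mkquatE; by field.
Qed.

Lemma perp_exists I : imag_units I -> exists2 J, imag_units J & perp I J.
Proof.
move=> hI; have [r0 n1] := imag_units_coords hI.
have [h|h] := eqVneq (qi I ^+ 2 + qj I ^+ 2) 0.
  (* Here I is k or -k, so i is perpendicular to it. Otherwise the (i, j) part of I is turned by a
     right angle and normalized. *)
  exists (mkquat 0 1 0 0); first by apply: imag_unitsP; rewrite !mkquatE; ring.
  by rewrite /perp /qdot !mkquatE; nra.
pose s := Num.sqrt (qi I ^+ 2 + qj I ^+ 2).
have s2 : s ^+ 2 = qi I ^+ 2 + qj I ^+ 2 by rewrite sqr_sqrtr; nra.
have s0 : s != 0 by apply: contra_neq h => s0; rewrite -s2 s0 expr0n.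
exists (mkquat 0 (- qj I / s) (qi I / s) 0).
  apply: imag_unitsP; rewrite !mkquatE// expr0n addr0 !expr_div_n sqrrN -mulrDl.
  by rewrite addrC -s2 divff// expf_eq0.
by rewrite /perp /qdot !mkquatE; by field.
Qed.

Lemma perp_anticomm I J : imag_units I -> imag_units J -> perp I J ->
  I * J = - (J * I).
Proof.
move=> /imag_units_coords[i0 i1] /imag_units_coords[j0 j1].
rewrite /perp /qdot i0 j0 => ij.
apply/eqP; rewrite -addr_eq0; apply/eqP; rewrite !quatME.
by apply: quatP; rewrite quatDE !mkquatE quat0E i0 j0; lra.
Qed.

(** The exponential of t I, by Euler's formula. *)
Definition cis I (t : R) : quat R := (cos t)%:A + sin t *: I.

Lemma slice_cis I t : slice I (cis I t).
Proof. by exists (cos t), (sin t). Qed.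

Lemma cis0 I : cis I 0 = 1.
Proof. by rewrite /cis cos0 sin0 scale1r scale0r addr0. Qed.

Lemma cisD I s t : imag_units I -> cis I (s + t) = cis I s * cis I t.
Proof.
move=> hI; rewrite /cis cosD sinD.
rewrite !mulrDr !mulrDl -!qscalerAl -!qscalerAr ?mul1r ?mulr1 -expr2 hI.
by rewrite !scalerA; qlinear.
Qed.

Lemma cisX I t n : imag_units I -> cis I t ^+ n = cis I (t *+ n).
Proof.
move=> hI; elim: n => [|n IH]; first by rewrite expr0 mulr0n cis0.
by rewrite exprS IH mulrS cisD.
Qed.

Lemma cis_norm I t : imag_units I -> `|cis I t| <= 1.
Proof.
move=> /imag_units_coords[r0 n1].
have h (c : R) : c ^+ 2 <= 1 -> `|c| <= 1.
  by move=> c1; rewrite -(ler_pXn2r (n := 2)) ?nnegrE// expr1n real_normK// num_real.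
have cs := cos2Dsin2 t; apply: qnorm_le => //; apply: h;
  rewrite /cis quatDE !quatZE quat1E !mkquatE ?r0; nra.
Qed.

End SliceAlgebra.

(** * Roots of unity in a slice *)

Section RootsOfUnity.
Variables (R : realType) (I : quat R).
Hypothesis hI : imag_units I.

Definition zeta N := cis I (2 * pi / N%:R).
Definition zetaV N := cis I (- (2 * pi / N%:R)).

(** Half angles: 1 - cos x is twice the square of sin (x / 2), and the sine is positive on (0,
    pi). *)
Lemma cos_eq1 (x : R) : 0 < x < 2 * pi -> cos x != 1.
Proof.
move=> /andP[x0 x1]; apply/eqP => c1.
have s0 : 0 < sin (x / 2) by apply: sin_gt0_pi; rewrite divr_gt0//= ltr_pdivrMr// mulrC.
have := cos2Dsin2 (x / 2).
move: c1; rewrite [x in cos x](splitr x) cosD; nra.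
Qed.

Lemma zetaM N : zeta N * zetaV N = 1.
Proof. by rewrite /zeta /zetaV -cisD// subrr cis0. Qed.

Lemma zetaX_norm N k : `|zeta N ^+ k| <= 1.
Proof. by rewrite cisX// cis_norm. Qed.

Lemma zetaVX_norm N k : `|zetaV N ^+ k| <= 1.
Proof. by rewrite cisX// cis_norm. Qed.

Lemma zetaXN N : (0 < N)%N -> zeta N ^+ N = 1.
Proof.
move=> N0; rewrite cisX// -[X in cis I X]mulr_natr divfK ?pnatr_eq0 -?lt0n//.
by rewrite /cis mulr_natl cos2pi sin2pi scale1r scale0r addr0.
Qed.

Lemma zetaVXN N : (0 < N)%N -> zetaV N ^+ N = 1.
Proof.
move=> N0; rewrite cisX// -[X in cis I X]mulr_natr mulNr divfK ?pnatr_eq0 -?lt0n//.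
by rewrite /cis mulr_natl cosN sinN cos2pi sin2pi oppr0 scale1r scale0r addr0.
Qed.

Lemma cis_re (t : R) : qre (cis I t) = cos t.
Proof.
have [r0 _] := imag_units_coords hI.
by rewrite /cis quatDE !quatZE quat1E mkquatE r0 mulr1 mulr0 addr0.
Qed.

Lemma zetaX_neq1 N n : (0 < n < N)%N -> zeta N ^+ n != 1.
Proof.
move=> /andP[n0 nN]; apply/eqP => /(congr1 (@qre R)).
rewrite cisX// cis_re quat1E mkquatE; apply/eqP; apply: cos_eq1.
have N0 : (0 : R) < N%:R by rewrite ltr0n (leq_ltn_trans _ nN).
rewrite -[X in _ < X < _]mulr_natr; apply/andP; split.
  by rewrite !mulr_gt0 ?invr_gt0 ?pi_gt0// ltr0n.
rewrite mulrAC -mulrA gtr_pMr ?mulr_gt0 ?pi_gt0//.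
by rewrite ltr_pdivrMr// mul1r ltr_nat.
Qed.

Lemma zetaVX_neq1 N n : (0 < n < N)%N -> zetaV N ^+ n != 1.
Proof.
move=> nN; apply: contra_neq (zetaX_neq1 nN) => h.
have : zeta N ^+ n * zetaV N ^+ n = 1.
  rewrite -exprMn_comm ?zetaM ?expr1n//.
  exact: slice_mulC (slice_cis _ _) (slice_cis _ _).
by rewrite h mulr1.
Qed.

Lemma sum_zetaVX N n : (0 < n < N)%N -> \sum_(k < N) (zetaV N ^+ k) ^+ n = 0.
Proof.
move=> nN; have N0 : (0 < N)%N by case/andP: nN => ? /(leq_ltn_trans _) ->.
under eq_bigr do rewrite exprAC.
(* The geometric sum times its ratio minus 1 is 0; the ratio is not 1, and there are no zero
   divisors. *)
have [] := @quat_mul_eq0 R (zetaV N ^+ n - 1) (\sum_(k < N) (zetaV N ^+ n) ^+ k).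
- by rewrite -subrX1 exprAC zetaVXN// expr1n subrr.
- by move/eqP; rewrite subr_eq0 (negPf (zetaVX_neq1 nN)).
- by [].
Qed.

Lemma zeta_cvg : zeta N @[N --> \oo] --> (1 : quat R).
Proof.
have h : 2 * pi * n.+1%:R^-1 @[n --> \oo] --> (0 : R).
  rewrite -[X in _ --> X](mulr0 (2 * pi : R)).
  by apply: cvgM; [exact: cvg_cst|exact: cvg_harmonic].
suff : zeta n.+1 @[n --> \oo] --> cis I 0 
  by rewrite cis0 => h1; rewrite -(cvg_shiftS zeta).
rewrite /zeta /cis.
apply: cvgD; apply: cvgZl.
- exact: (cvg_comp _ _ h (@continuous_cos R 0)).
- exact: (cvg_comp _ _ h (@continuous_sin R 0)).
Qed.

End RootsOfUnity.

(** * A discrete Cauchy theorem on one slice *)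

Lemma is_derive_qmull (R : realType) (c : quat R) (F : R -> quat R) (t : R) d :
  is_derive t (1 : R) F d -> is_derive t (1 : R) (fun s => c * F s) (c * d).
Proof.
move=> [dF <-].
have E : (fun h : R => h^-1 *: (((fun s => c * F s) \o shift t) (h *: (1 : R)) - c * F t))
  = (fun h : R => qmulf c (h^-1 *: ((F \o shift t) (h *: (1 : R)) - F t))).
  by apply/funext => h /=; rewrite /qmulf -mulrBr -qscalerAr.
have L : qmulf c (h^-1 *: ((F \o shift t) (h *: (1 : R)) - F t)) @[h --> (0 : R)^'] -->
    qmulf c ('D_1 F t).
  exact: (continuous2_cvg _ (@qmul_continuous R (c, 'D_1 F t)) (cvg_cst c) dF).
split; rewrite /derivable /derive E; first by apply/cvg_ex; exists (qmulf c ('D_1 F t)).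
exact: cvg_lim L.
Qed.

Lemma is_derive_scalel (R : realType) (c : quat R) (t : R) :
  is_derive t (1 : R) (fun s : R => s *: c) c.
Proof.
have := @is_derive_line R id 0 c t (@derivable_id _ _ _ _).
by rewrite derive_id; under eq_fun do rewrite /= add0r.
Qed.

Section Cauchy.
Variables (R : realType) (I : quat R) (f : quat R -> quat R).
Hypothesis hI : imag_units I.
Hypothesis f_class : of_class 1 f.
Hypothesis f_dbar : forall q, slice I q -> 'D_1 f q + I * 'D_I f q = 0.
Implicit Types (z p q h : quat R).

(** The Cauchy-Riemann equation makes the differential along the slice left multiplication by the
    complex derivative 'D_1 f. *)
Lemma slice_derive q h : slice I q -> slice I h -> 'D_h f q = h * 'D_1 f q.
Proof.
move=> hq [x [y ->]]; have [df _] := f_class.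
have e : 'D_I f q = I * 'D_1 f q.
  rewrite -['D_1 f q](addrK (I * 'D_I f q)) f_dbar// sub0r mulrN mulrA -expr2 hI.
  by rewrite mulN1r opprK.
rewrite deriveE// linearD !linearZ /= -!deriveE// e mulrDl -!qscalerAl mul1r.
by [].
Qed.

(** Subtracting the linear part along the segment leaves the derivative h (f'(p + t h) - f'(p)),
    small by uniform continuity of f'. Using e / 4 compensates the 4 of [qnormM]. *)
Lemma slice_taylor (r e : R) : 0 < e -> exists2 d, 0 < d &
  forall p h, slice I p -> slice I h -> `|p| <= r -> `|p + h| <= r ->
    `|h| < d -> `|f (p + h) - f p - h * 'D_1 f p| <= e * `|h|.
Proof.
move=> e0; have [df Df] := f_class.
have e40 : 0 < e / 4 by rewrite divr_gt0.
have [d d0 hd] := heine_cantor r (Df 1) e40.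
exists d => // p h hp hh pr phr hhd.
pose u (t : R) : quat R := f (p + t *: h) - t *: (h * 'D_1 f p).
have -> : f (p + h) - f p - h * 'D_1 f p = u 1 - u 0.
  by rewrite /u !scale1r !scale0r addr0 subr0 addrAC.
apply: (@mean_value_le _ u (fun t => h * ('D_1 f (p + t *: h) - 'D_1 f p))).
- move=> t t01; have hpt : slice I (p + t *: h) by apply: sliceD => //; exact: sliceZ.
  rewrite mulrBr -(slice_derive hpt hh).
  apply: is_deriveB; first by apply: is_derive_line; exact: diff_derivable.
  exact: is_derive_scalel.
- move=> t /andP[t0 t1]; apply: le_trans (qnormM _ _) _.
  have : `|'D_1 f (p + t *: h) - 'D_1 f p| < e / 4.
    apply: hd => //; rewrite addrAC subrr add0r normrZ gtr0_norm//.
    by apply: le_lt_trans hhd; rewrite ler_piMl// ltW.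
  by move=> /ltW /(ler_wpM2l (normr_ge0 h)); lra.
- by rewrite mulr_ge0// ltW.
Qed.

Variable r : R.
Hypothesis r0 : 0 < r.

(** The points of the Riemann sums on the circle of radius r in the slice; [nodeV] gives their
    inverses. *)
Definition node N k : quat R := r *: zeta I N ^+ k.
Definition nodeV N k : quat R := r^-1 *: zetaV I N ^+ k.

Lemma slice_node N k : slice I (node N k).
Proof. by apply: sliceZ; apply: sliceX => //; exact: slice_cis. Qed.

Lemma slice_nodeV N k : slice I (nodeV N k).
Proof. by apply: sliceZ; apply: sliceX => //; exact: slice_cis. Qed.

Lemma node_norm N k : `|node N k| <= r.
Proof. by rewrite normrZ gtr0_norm// ler_piMr ?zetaX_norm// ltW. Qed.

Lemma nodeVX_norm N k n : `|nodeV N k ^+ n| <= r^-1 ^+ n.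
Proof.
rewrite exprZn normrZ ger0_norm ?exprn_ge0 ?invr_ge0 ?(ltW r0)//.
by rewrite -exprM ler_piMr ?zetaVX_norm// exprn_ge0// invr_ge0 ltW.
Qed.

Lemma nodeVM N k : nodeV N k * node N k = 1.
Proof.
rewrite /node /nodeV -qscalerAl -qscalerAr scalerA mulVf ?gt_eqF// scale1r.
rewrite -exprMn_comm; last exact: slice_mulC (slice_cis _ _) (slice_cis _ _).
rewrite (slice_mulC (slice_cis _ _) (slice_cis _ _)) zetaM// expr1n.
by [].
Qed.

Lemma segment_norm z w (t : R) : 0 <= t <= 1 -> `|z| <= r -> `|w| <= r ->
  `|z + t *: (w - z)| <= r.
Proof.
move=> /andP[t0 t1] zr wr.
rewrite (_ : _ + _ = (1 - t) *: z + t *: w); last by qlinear.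
apply: le_trans (ler_normD _ _) _; rewrite !normrZ !ger0_norm ?subr_ge0//.
by have := ler_wpM2l t0 wr; have := ler_wpM2l (_ : 0 <= 1 - t) zr;
  rewrite subr_ge0 => /(_ t1); lra.
Qed.

(* The increments of f around the closed polygon z + t (node N k - z) add up to
   0; to first order they are t (zeta I N - 1) times the terms of this sum. *)
Lemma sum_node_derive_small (e : R) : 0 < e -> \forall N \near \oo,
  forall z (t : R), slice I z -> `|z| <= r -> 0 < t < 1 ->
  `|\sum_(k < N) node N k * 'D_1 f (z + t *: (node N k - z))| <= N%:R * e.
Proof.
move=> e0.
(* The step length |H k| brings a factor 4 r, and division by zeta - 1 another 4. *)
have e'0 : 0 < e / (16 * r) by rewrite divr_gt0// mulr_gt0.
have [d d0 hd] := slice_taylor r e'0.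
have z1 := @zeta_cvg R I.
have r40 : 0 < 4 * r by rewrite mulr_gt0.
near=> N.
have N1 : (1 < N)%N by near: N; exact: nbhs_infty_gt.
have zd : `|zeta I N - 1| < d / (4 * r).
  by near: N; move/cvgrPdistC_lt : z1; apply; rewrite divr_gt0.
move=> z t hz zr /andP[t0 t1].
set A := \sum_(k < N) _.
pose P k := z + t *: (node N k - z).
have hP k : slice I (P k).
  apply: sliceD => //; apply: sliceZ; apply: sliceB => //; exact: slice_node.
pose H k := (t *: (zeta I N - 1)) * node N k.
have sz : slice I (zeta I N - 1) by apply: sliceB; [exact: slice_cis|exact: slice1].
have hH k : slice I (H k).
  by apply: sliceM => //; [exact: sliceZ|exact: slice_node].
have PS k : P k.+1 = P k + H k.
  rewrite /P /H /node exprS -qscalerAl mulrBl mul1r -qscalerAr; qlinear.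
have sum0 : \sum_(k < N) (f (P k.+1) - f (P k)) = 0.
  rewrite -(big_mkord xpredT (fun k => f (P k.+1) - f (P k))) telescope_sumr//.
  by rewrite /P /node zetaXN// ?expr0 ?subrr// ltnW.
have sumH : \sum_(k < N) H k * 'D_1 f (P k) = t *: ((zeta I N - 1) * A).
  rewrite mulr_sumr scaler_sumr; apply: eq_bigr => k _.
  by rewrite /H -mulrA -qscalerAl.
have n0 : 0 < `|zeta I N - 1|.
  by rewrite normr_gt0 subr_eq0 -[zeta I N]expr1 zetaX_neq1.
have Hn k : `|H k| <= t * (4 * (`|zeta I N - 1| * r)).
  rewrite /H -qscalerAl normrZ gtr0_norm// ler_wpM2l ?(ltW t0)//.
  apply: le_trans (qnormM _ _) _; rewrite !ler_wpM2l//.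
  exact: node_norm.
have Hd k : `|H k| < d.
  apply: le_lt_trans (Hn k) _.
  apply: (@le_lt_trans _ _ (1 * (4 * (`|zeta I N - 1| * r)))).
    by rewrite ler_wpM2r ?mulr_ge0// ltW.
  by rewrite mul1r mulrCA -ltr_pdivlMr.
have le1 : `|t *: ((zeta I N - 1) * A)| <=
    N%:R * (e / (16 * r) * (t * (4 * (`|zeta I N - 1| * r)))).
  rewrite (_ : t *: _ = - \sum_(k < N) (f (P k.+1) - f (P k) - H k * 'D_1 f (P k)));
    last by rewrite sumrB sum0 sub0r opprK sumH.
  rewrite normrN.
  apply: le_trans (ler_norm_sum _ _ _) _.
  rewrite mulr_natl -[X in _ *+ X]card_ord -sumr_const.
  apply: ler_sum => k _; rewrite PS.
  apply: (@le_trans _ _ (e / (16 * r) * `|H k|)).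
    have Pn j : `|P j| <= r by apply: segment_norm; rewrite ?node_norm// !ltW.
    by apply: hd => //; rewrite -PS.
  by rewrite ler_wpM2l// ltW.
have -> : A = (zeta I N - 1)^-1 * ((zeta I N - 1) * A).
  by rewrite mulrA mulVr ?mul1r// qunit// -normr_gt0.
apply: le_trans (qnormM _ _) _.
move: le1; rewrite normrZ gtr0_norm// => le1.
(* Both sides carry the factor t > 0; cancelling it makes the estimate uniform in t. *)
have le2 : `|(zeta I N - 1) * A| <= N%:R * (e / (16 * r) * (4 * (`|zeta I N - 1| * r))).
  rewrite -(ler_pM2l t0); apply: le_trans le1 _.
  by rewrite le_eqVlt; apply/orP; left; apply/eqP; ring.
apply: (@le_trans _ _ (4 * (`|zeta I N - 1|^-1 *
    (N%:R * (e / (16 * r) * (4 * (`|zeta I N - 1| * r))))))).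
  rewrite ler_wpM2l//; apply: ler_pM => //.
  by apply: qnV; rewrite -normr_gt0.
rewrite le_eqVlt; apply/orP; left; apply/eqP; field.
by rewrite (gt_eqF n0) (gt_eqF r0).
Unshelve. all: by end_near. Qed.

End Cauchy.

(** * A discrete Cauchy formula with truncated kernel *)

Section CauchyCoefficients.
Variables (R : realType) (I : quat R) (f : quat R -> quat R).
Hypothesis hI : imag_units I.
Hypothesis f_class : of_class 1 f.
Hypothesis f_dbar : forall q, slice I q -> 'D_1 f q + I * 'D_I f q = 0.
Implicit Types (z p q h : quat R).
Variable r : R.
Hypothesis r0 : 0 < r.

Local Notation node := (node I r).
Local Notation nodeV := (nodeV I r).

(* A Riemann sum for the Cauchy integral of the n-th Taylor coefficient. *)
Definition coef N n : quat R :=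
  N%:R^-1 *: \sum_(k < N) nodeV N k ^+ n * f (node N k).

(** Cauchy estimates with M independent of N: for fixed n the coefficients stay in one compact ball
    as N grows. *)
Lemma coef_bound : exists2 M, 0 <= M & forall N n, `|coef N n| <= M * r^-1 ^+ n.
Proof.
have [M M0 hM] := continuous_bounded r (of_classW f_class).
exists (4 * M); first by rewrite mulr_ge0.
move=> N n; have ri0 : 0 <= r^-1 ^+ n by rewrite exprn_ge0// invr_ge0 ltW.
rewrite /coef normrZ; have [->|N0] := posnP N.
  by rewrite big_ord0 normr0 mulr0 !mulr_ge0.
have NR : (0 : R) < N%:R by rewrite ltr0n.
rewrite gtr0_norm ?invr_gt0// ler_pdivrMl//.
apply: le_trans (ler_norm_sum _ _ _) _.
rewrite [leRHS]mulr_natl -[X in _ *+ X]card_ord -sumr_const.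
apply: ler_sum => k _; apply: le_trans (qnormM _ _) _.
rewrite -mulrA ler_wpM2l// mulrC; apply: ler_pM => //.
  by apply: hM; exact: node_norm.
exact: nodeVX_norm.
Qed.

(* The Cauchy kernel w / (w - z) at w = node N k, as a geometric sum in z / w
   truncated at order m, so that only powers of w^-1 = nodeV N k occur. *)
Let kernel N m z k : quat R := \sum_(n < m) (z * nodeV N k) ^+ n.

(** The telescoping of a finite geometric sum in x = z / w, multiplied by w; everything lies in one
    slice and so commutes. *)
Lemma kernelM N m z k : slice I z ->
  kernel N m z k * (node N k - z) = node N k - (z * nodeV N k) ^+ m * node N k.
Proof.
move=> hz.
have e : node N k - z = (1 - z * nodeV N k) * node N k.
  by rewrite mulrBl mul1r -mulrA nodeVM// mulr1.
rewrite e mulrA -[in RHS](mul1r (node N k)) mulrA mulr1 -mulrBl; congr (_ * _).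
apply: oppr_inj; rewrite -mulrN !opprB /kernel subrX1.
apply: (@slice_mulC _ I).
  apply: (big_ind (slice I)); [exact: slice0|by move=> *; apply: sliceD|].
  by move=> i _; apply: sliceX => //; apply: sliceM => //; exact: slice_nodeV.
apply: sliceB; last exact: slice1.
by apply: sliceM => //; exact: slice_nodeV.
Qed.

Lemma kernelE N m z k : slice I z ->
  kernel N m z k = \sum_(n < m) z ^+ n * nodeV N k ^+ n.
Proof.
move=> hz; apply: eq_bigr => n _; apply: exprMn_comm.
exact: slice_mulC hz (slice_nodeV hI r _ _).
Qed.

Lemma sum_kernel_node N m z : slice I z ->
  N%:R^-1 *: \sum_(k < N) kernel N m z k * f (node N k) =
  \sum_(n < m) z ^+ n * coef N n.
Proof.
move=> hz; under eq_bigr do rewrite kernelE// mulr_suml.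
rewrite exchange_big scaler_sumr; apply: eq_bigr => n _ /=.
rewrite /coef -qscalerAr mulr_sumr; congr (_ *: _); apply: eq_bigr => k _.
by rewrite mulrA.
Qed.

(** Averaging over the roots of unity kills the powers 0 < n < N, so for m <= N only n = 0
    survives. *)
Lemma sum_kernel N m z : slice I z -> (0 < m <= N)%N ->
  N%:R^-1 *: \sum_(k < N) kernel N m z k = 1.
Proof.
move=> hz /andP[m0 mN].
have NR : (N%:R : R) != 0 by rewrite pnatr_eq0 -lt0n (leq_trans m0).
under eq_bigr do rewrite kernelE//.
rewrite exchange_big /=; case: m m0 mN => // m _ mN.
rewrite big_ord_recl [X in _ + X]big1 => [|n _]; last first.
  rewrite -mulr_sumr.
  under eq_bigr do rewrite exprZn.
  rewrite -scaler_sumr sum_zetaVX ?scaler0 ?mulr0//.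
  exact: leq_ltn_trans (ltn_ord n) mN.
under eq_bigr do rewrite !expr0 mulr1.
by rewrite sumr_const card_ord addr0 -[X in _ *: X]scaler_nat scalerA mulVf// scale1r.
Qed.

(** Contract the circle to z: the kernel mean u(t) of f at z + t (w - z) goes from f z at t = 0 to
    the Taylor sum at t = 1. By [kernelM], its derivative is a mean of w f', small by the discrete
    Cauchy theorem, minus a term with the factor (z / w)^m. *)
Lemma cauchy_approx : exists2 C, 0 <= C & forall e : R, 0 < e ->
  \forall N \near \oo, forall z m, slice I z -> `|z| <= r -> (0 < m <= N)%N ->
  `|f z - \sum_(n < m) z ^+ n * coef N n| <= e + C * (16 * `|z| / r) ^+ m.
Proof.
have [df Df] := f_class.
have [M M0 hM] := continuous_bounded r (Df 1).
(* One factor 4 comes from [qnX] and two more from measuring the node and the derivative by [qn];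
   likewise 16 |z| / r bounds [qn] of z / w. *)
exists (64 * r * M); first by rewrite !mulr_ge0// ltW.
move=> e e0.
have := sum_node_derive_small hI f_class f_dbar r0 e0; apply: filterS.
move=> N hN z m hz zr mN.
have N0 : (0 < N)%N by case/andP: mN => m0 /(leq_trans m0).
have NR : (0 : R) < N%:R by rewrite ltr0n.
pose P k (t : R) : quat R := z + t *: (node N k - z).
pose u (t : R) : quat R := N%:R^-1 *: \sum_(k < N) kernel N m z k * f (P k t).
pose du (t : R) : quat R := N%:R^-1 *:
  \sum_(k < N) kernel N m z k * ((node N k - z) * 'D_1 f (P k t)).
have sP k t : slice I (P k t).
  apply: sliceD => //; apply: sliceZ; apply: sliceB => //; exact: slice_node.
have sk k : slice I (node N k - z) by apply: sliceB => //; exact: slice_node.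
have u1 : u 1 = \sum_(n < m) z ^+ n * coef N n.
  rewrite -sum_kernel_node// /u; congr (_ *: _); apply: eq_bigr => k _.
  by rewrite /P scale1r addrC subrK.
have u0 : u 0 = f z.
  rewrite /u; under eq_bigr do rewrite /P scale0r addr0.
  by rewrite -mulr_suml qscalerAl sum_kernel// mul1r.
rewrite distrC -u1 -u0.
have C0 : 0 <= e + 64 * r * M * (16 * `|z| / r) ^+ m.
  rewrite addr_ge0 ?(ltW e0)// !mulr_ge0 ?(ltW r0)// exprn_ge0//.
  by rewrite !mulr_ge0// invr_ge0 ltW.
apply: (@mean_value_le _ u du) => // t t01.
  apply: is_deriveZ.
  have -> : (fun s => \sum_(k < N) kernel N m z k * f (P k s)) =
      \sum_(k < N) (fun s => kernel N m z k * f (P k s)).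
    by rewrite fct_sumE.
  apply: is_derive_sum => k; apply: is_derive_qmull.
  rewrite -(slice_derive hI f_class f_dbar (sP k t) (sk k)).
  by apply: is_derive_line; exact: diff_derivable.
have -> : du t = N%:R^-1 *: (\sum_(k < N) node N k * 'D_1 f (P k t)
    - \sum_(k < N) (z * nodeV N k) ^+ m * (node N k * 'D_1 f (P k t))).
  rewrite /du -sumrB; congr (_ *: _); apply: eq_bigr => k _.
  by rewrite mulrA kernelM// mulrBl mulrA.
rewrite normrZ gtr0_norm ?invr_gt0// ler_pdivrMl// mulrDr.
apply: le_trans (ler_normB _ _) _; apply: lerD; first exact: hN.
apply: le_trans (ler_norm_sum _ _ _) _.
rewrite [leRHS]mulr_natl -[X in _ *+ X]card_ord -sumr_const.
apply: ler_sum => k _.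
apply: le_trans (norm_le_qn _) _; apply: le_trans (qnM _ _) _.
have dM : `|'D_1 f (P k t)| <= M.
  apply: hM; apply: segment_norm; rewrite ?node_norm//.
  by case/andP: t01 => t0 t1; rewrite !ltW.
rewrite (_ : 64 * r * M * _ = 4 * (16 * `|z| / r) ^+ m * (4 * r * (4 * M)));
  last by ring.
have zv : qn (z * nodeV N k) <= 16 * `|z| / r.
  apply: le_trans (qnM _ _) _; have := @nodeVX_norm _ _ hI _ r0 N k 1.
  rewrite !expr1 => h; rewrite /qn (_ : 16 * `|z| / r = 4 * `|z| * (4 * r^-1));
    last by ring.
  by rewrite ler_wpM2l ?mulr_ge0// ler_wpM2l.
apply: ler_pM; rewrite ?qn_ge0//.
  apply: le_trans (qnX _ _) _; rewrite ler_wpM2l//.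
  by rewrite lerXn2r ?nnegrE ?qn_ge0// (le_trans _ zv) ?qn_ge0.
apply: le_trans (qnM _ _) _; apply: ler_pM; rewrite ?qn_ge0// /qn ler_wpM2l//.
exact: node_norm.
Qed.

End CauchyCoefficients.

(** * Power series expansion of slice regular functions *)

Lemma ultra_compact_cvg (T : Type) (X : topologicalType) (U : set_system T)
    (f : T -> X) (A : set X) :
  UltraFilter U -> compact A -> U (f @^-1` A) -> exists2 p, A p & f @ U --> p.
Proof.
move=> UU cA UA; have [p [Ap clp]] := cA (f @ U) _ UA.
exists p => // V Vp; have [//|UnV] := in_ultra_setVsetC (f @^-1` V) UU.
by have [x [nVx /nVx]] := clp (~` V) V UnV Vp.
Qed.

Section TaylorSeries.
Variables (R : realType) (f : quat R -> quat R).
Hypothesis f_regular : slice_regular f.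
Implicit Types (I z p q h : quat R).

Let f_class : of_class 1 f. Proof. by case: f_regular. Qed.

Lemma slice_regular_dbar I q : imag_units I -> slice I q ->
  'D_1 f q + I * 'D_I f q = 0.
Proof.
move=> hI hq; case: f_regular => _ /(_ I hI q hq) /= /eqP.
by rewrite /dbar scaler_eq0 invr_eq0 pnatr_eq0 /= => /eqP.
Qed.

(** When 16 |z| < r the right side tends to 0 as m grows, so a given z is reached by taking r
    large. *)
Definition taylor I (r : R) (c : (quat R)^nat) (C : R) :=
  (exists M, forall n, `|c n| <= M * r^-1 ^+ n) /\
  forall z m, slice I z -> `|z| <= r -> (0 < m)%N ->
    `|f z - \sum_(n < m) z ^+ n * c n| <= C * (16 * `|z| / r) ^+ m.

(* The coefficients are the limits, along an ultrafilter, of Riemann sums. *)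
Lemma taylor_exists I r : imag_units I -> 0 < r ->
  exists c C, taylor I r c C.
Proof.
move=> hI r0.
have f_dbar q := @slice_regular_dbar I q hI.
have [M M0 hM] := coef_bound hI f_class r0.
have [C C0 hC] := cauchy_approx hI f_class f_dbar r0.
have [U [UU sU]] := @ultraFilterLemma nat \oo _.
have hc n : exists2 c, `|c| <= M * r^-1 ^+ n & coef I f r N n @[N --> U] --> c.
  apply: (ultra_compact_cvg (A := [set q : quat R | `|q| <= M * r^-1 ^+ n])) => //.
    exact: qball_compact.
  by apply: filterS filterT => N _ /=.
pose c n := projT1 (cid2 (hc n)).
have cn n : `|c n| <= M * r^-1 ^+ n by rewrite /c; case: cid2.
have cU n : coef I f r N n @[N --> U] --> c n by rewrite /c; case: cid2.
exists c, C; split; first by exists M.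
move=> z m hz zr m0.
apply/ler_addgt0Pl => e e0.
have lim : `|f z - \sum_(n < m) z ^+ n * coef I f r N n| @[N --> U] -->
    `|f z - \sum_(n < m) z ^+ n * c n|.
  apply: cvg_norm; apply: cvgB; first exact: cvg_cst.
  apply: cvg_big => //; first by move=> x; exact: add_continuous.
  move=> i _.
  exact: (continuous2_cvg _ (@qmul_continuous R (z ^+ i, c i)) (cvg_cst _) (cU i)).
apply: cvgr_to_le lim _.
have := sU _ (hC e e0) => h1.
have := sU _ (nbhs_infty_ge m) => h2.
near=> N; have := near h1 N; apply => //.
by rewrite m0 /=; near: N.
Unshelve. all: by end_near. Qed.

(** Real points lie on every slice. If the lower coefficients agree, comparing both expansions at a
    small real x bounds the difference of the n-th coefficients by D x. *)
Lemma taylor_unique I1 I2 r1 r2 c1 c2 C1 C2 : 0 < r1 -> 0 < r2 ->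
  taylor I1 r1 c1 C1 -> taylor I2 r2 c2 C2 -> c1 = c2.
Proof.
move=> r10 r20 [_ h1] [_ h2]; apply/funext => n.
elim/ltn_ind: n => n IH.
pose D := `|C1| * (16 / r1) ^+ n.+1 + `|C2| * (16 / r2) ^+ n.+1.
have D0 : 0 <= D.
  by rewrite addr_ge0// mulr_ge0// exprn_ge0// divr_ge0// ltW.
have small x : 0 < x -> x <= r1 -> x <= r2 -> `|c1 n - c2 n| <= D * x.
  move=> x0 x1 x2.
  have nx : `|(x%:A : quat R)| = x by rewrite normrZ qnorm1 mulr1 gtr0_norm.
  have e1 := h1 x%:A n.+1 (slice_real _ _).
  have e2 := h2 x%:A n.+1 (slice_real _ _).
  move: e1 e2; rewrite nx => /(_ x1 isT) e1 /(_ x2 isT) e2.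
  have : `|x%:A ^+ n * (c1 n - c2 n)| <= D * x ^+ n.+1.
    have -> : x%:A ^+ n * (c1 n - c2 n) =
       (f x%:A - \sum_(i < n.+1) x%:A ^+ i * c2 i)
       - (f x%:A - \sum_(i < n.+1) x%:A ^+ i * c1 i).
      have S : \sum_(i < n) x%:A ^+ i * c1 i = \sum_(i < n) x%:A ^+ i * c2 i.
        by apply: eq_bigr => i _; rewrite IH.
      by rewrite !big_ord_recr /= S mulrBr; qlinear.
    apply: le_trans (ler_normB _ _) _.
    rewrite /D mulrDl addrC; apply: lerD.
      apply: le_trans e1 _; rewrite [16 * x / _]mulrAC exprMn mulrA.
      by rewrite !ler_wpM2r ?ler_norm// exprn_ge0// ?divr_ge0// ltW.
    apply: le_trans e2 _; rewrite [16 * x / _]mulrAC exprMn mulrA.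
    by rewrite !ler_wpM2r ?ler_norm// exprn_ge0// ?divr_ge0// ltW.
  have -> : (x%:A : quat R) ^+ n = (x ^+ n)%:A by rewrite exprZn expr1n.
  rewrite -qscalerAl mul1r normrZ gtr0_norm ?exprn_gt0//.
  by rewrite exprSr mulrA [_ * x ^+ n]mulrC -mulrA ler_pM2l ?exprn_gt0.
apply/eqP; rewrite -subr_eq0 -normr_le0 leNgt; apply/negP => d0.
pose x := Num.min (Num.min r1 r2) (`|c1 n - c2 n| / (2 * (D + 1))).
have D1 : 0 < 2 * (D + 1) by rewrite mulr_gt0// ltr_wpDl.
have x0 : 0 < x by rewrite !lt_min r10 r20 divr_gt0.
have := small x x0; rewrite !ge_min !lexx ?orbT => /(_ isT isT).
have : x * (2 * (D + 1)) <= `|c1 n - c2 n|.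
  by rewrite -ler_pdivlMr// ge_min lexx orbT.
have : 0 <= D * x by rewrite mulr_ge0// ltW.
rewrite (_ : x * (2 * (D + 1)) = 2 * (D * x) + 2 * x); last by ring.
lra.
Qed.

Lemma slice_regular_pser : exists2 a, entire a & f = pser a [::].
Proof.
have [I0 hI0 _] := slice_exists (0 : quat R).
have [a [C0 ta]] := taylor_exists hI0 ltr01.
(* The coefficients found for one slice and radius 1 serve every slice and radius, by uniqueness. *)
have taI I r : imag_units I -> 0 < r -> exists C, taylor I r a C.
  move=> hI r0; have [c [C tc]] := taylor_exists hI r0.
  by exists C; rewrite (taylor_unique ltr01 r0 ta tc).
exists a.
  (* X may be 0, hence the positive radius X + 1. *)
  move=> X X0; have [C [[M hM] _]] := taI I0 (X + 1) hI0 (ltr_wpDl X0 ltr01).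
  exists (4 * M) => n.
  have X1 : 0 < X + 1 by rewrite ltr_wpDl.
  have M0 : 0 <= M by have := hM 0%N; rewrite expr0 mulr1; apply: le_trans.
  rewrite /qn -mulrA ler_wpM2l//.
  apply: (@le_trans _ _ (M * (X + 1)^-1 ^+ n * (X + 1) ^+ n)).
    apply: ler_pM => //; rewrite ?exprn_ge0//.
    by rewrite lerXn2r ?nnegrE ?(ltW X1)// lerDl.
  by rewrite -mulrA -exprMn mulVf ?expr1n ?mulr1// gt_eqF.
apply/funext => q; have [I hI hq] := slice_exists q.
(* This radius makes the ratio 16 |q| / r at most 1/2. *)
pose r := 32 * `|q| + 1.
have r0 : 0 < r by rewrite ltr_wpDl// mulr_ge0.
have [C [_ hC]] := taI I r hI r0.
apply/esym/cvg_lim => //; apply/cvgrPdist_le => e e0.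
have hr : 16 * `|q| / r <= 2^-1.
  by rewrite ler_pdivrMr// ler_pdivlMl// /r; have := normr_ge0 q; lra.
have h0 : `|C| * 2^-1 ^+ m @[m --> \oo] --> (0 : R).
  rewrite -[X in _ --> X](mulr0 `|C|); apply: cvgM; first exact: cvg_cst.
  by apply: cvg_expr; rewrite ger0_norm ?invf_lt1// ltr1n.
near=> m.
have m0 : (0 < m)%N by near: m; exact: nbhs_infty_gt.
rewrite /series /= big_mkord.
under eq_bigr do rewrite dpow_nil.
apply: le_trans (hC q m hq _ m0) _.
  by rewrite /r; have := normr_ge0 q; lra.
apply: (@le_trans _ _ (`|C| * 2^-1 ^+ m)).
  have p0 : 0 <= 16 * `|q| / r by rewrite divr_ge0 ?mulr_ge0// ltW.
  apply: le_trans (ler_wpM2r (exprn_ge0 _ p0) (ler_norm C)) _.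
  by rewrite ler_wpM2l// lerXn2r ?nnegrE.
by near: m; exact: (cvgr_le _ h0).
Unshelve. all: by end_near. Qed.

End TaylorSeries.

(** * Cauchy-Riemann calculus on a slice *)

Section SliceCalculus.
Variables (R : realType) (I : quat R).
Hypothesis hI : imag_units I.
Implicit Types (f g F G : quat R -> quat R) (p q v : quat R).

Lemma of_class_cst k (c : quat R) : of_class k (cst c : quat R -> quat R).
Proof.
elim: k c => [|k IH] c; first exact: cst_continuous.
split=> [x|v]; first exact: differentiable_cst.
have -> : 'D_v (cst c : quat R -> quat R) = cst 0.
  by apply/funext => x; rewrite derive_cst.
exact: IH.
Qed.

(** The difference quotients stay on the slice, so an identity known only there can be
    differentiated, and hence iterated. *)
Lemma derive_eq_slice F G q v : (forall p, slice I p -> F p = G p) ->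
  slice I q -> slice I v -> 'D_v F q = 'D_v G q.
Proof.
move=> FG hq hv; rewrite /derive.
suff -> : (fun h : R => h^-1 *: ((F \o shift q) (h *: v) - F q)) =
          (fun h : R => h^-1 *: ((G \o shift q) (h *: v) - G q)) by [].
apply/funext => h /=; rewrite !FG//.
by apply: sliceD => //; exact: sliceZ.
Qed.

Lemma dbar_eq_slice F G q : (forall p, slice I p -> F p = G p) ->
  slice I q -> dbar I F q = dbar I G q.
Proof.
move=> FG hq; rewrite /dbar (derive_eq_slice FG hq (slice1 I)).
by rewrite (derive_eq_slice FG hq (slice_unit I)).
Qed.

(* Writing f = F + G J on the slice with F and G in the centralizer of I, the
   values at s = -1 and s = 1 are F and G J, the parts of f that commute and
   anticommute with I. *)
Definition sandwich (s : R) f q : quat R := 2^-1 *: (f q + s *: (I * f q * I)).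

Lemma sandwich_split f q : sandwich (-1) f q + sandwich 1 f q = f q.
Proof. by rewrite /sandwich; apply/rowP => i; rewrite !quat_coordE; field. Qed.

Lemma sandwichE s f : sandwich s f = cst (2^-1)%:A \*
  (f \+ (cst s%:A \* ((cst I \* f) \* cst I))).
Proof.
apply/funext => q; rewrite /sandwich /= -!qscalerAl !mul1r.
by [].
Qed.

Lemma sandwich_class s f k : of_class k f -> of_class k (sandwich s f).
Proof.
move=> cf; rewrite sandwichE; do ?[exact: cf | exact: of_class_cst
  | apply: of_class_qmul | apply: of_class_add].
Qed.

Lemma derive_qmull (c : quat R) F q v : differentiable F q ->
  'D_v (cst c \* F) q = c * 'D_v F q.
Proof. by move=> dF; rewrite derive_qmul// derive_cst mul0r add0r. Qed.

Lemma derive_qmulr (c : quat R) F q v : differentiable F q ->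
  'D_v (F \* cst c) q = 'D_v F q * c.
Proof. by move=> dF; rewrite derive_qmul// derive_cst mulr0 addr0. Qed.

Lemma sandwich_differentiable s f q : differentiable f q ->
  differentiable (sandwich s f) q.
Proof.
have dc (c : quat R) : differentiable (cst c) q by [].
move=> df; rewrite sandwichE; apply: (differentiable_qmul (dc _)).
apply: (differentiableD df); apply: (differentiable_qmul (dc _)).
exact: differentiable_qmul (differentiable_qmul (dc _) df) (dc _).
Qed.

Lemma derive_sandwich s f q v : differentiable f q ->
  'D_v (sandwich s f) q = sandwich s ('D_v f) q.
Proof.
move=> df; have dc (c : quat R) : differentiable (cst c) q by [].
have d1 := differentiable_qmul (dc I) df.
have d2 := differentiable_qmul d1 (dc I).
have d3 := differentiable_qmul (dc s%:A) d2.
rewrite sandwichE derive_qmull; last exact: differentiableD.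
rewrite deriveD; [|exact: diff_derivable|exact: diff_derivable].
rewrite derive_qmull// derive_qmulr// derive_qmull//.
by rewrite -!qscalerAl !mul1r.
Qed.

Definition slice_CR F := forall q, slice I q -> 'D_I F q = I * 'D_1 F q.

Lemma mulII q : I * (I * q) = - q.
Proof. by rewrite mulrA -expr2 hI mulN1r. Qed.

Lemma mulIIr q : q * I * I = - q.
Proof. by rewrite -mulrA -expr2 hI mulrN1. Qed.

Lemma slice_CR_dbar F : slice_CR F ->
  forall q, slice I q -> 'D_1 F q + I * 'D_I F q = 0.
Proof. by move=> CR q hq; rewrite CR// mulII subrr. Qed.

Lemma sandwich_CR s f : (forall q, differentiable f q) -> slice_CR f ->
  slice_CR (sandwich s f).
Proof.
move=> df CR q hq; rewrite !derive_sandwich// /sandwich CR//.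
by rewrite -qscalerAr mulrDr -qscalerAr !mulrA.
Qed.

(** In the Leibniz expansion the two terms with F' cancel because I I = -1; what remains is (F + I F
    I) G' / 2. *)
Lemma dbar_mul F G q : slice I q ->
  (forall q, differentiable F q) -> (forall q, differentiable G q) ->
  slice_CR F -> slice_CR G ->
  dbar I (F \* G) q = sandwich 1 F q * 'D_1 G q.
Proof.
move=> hq dF dG CF CG; rewrite /dbar /sandwich !derive_qmul// CF// CG//.
rewrite scale1r -qscalerAl; congr (_ *: _).
by rewrite !mulrDr -[I * 'D_1 F q * G q]mulrA mulII mulrDl !mulrA; qlinear.
Qed.

Lemma sandwich_idem f q : sandwich 1 (sandwich 1 f) q = sandwich 1 f q.
Proof.
rewrite /sandwich !scale1r -qscalerAr -qscalerAl mulrDr mulrDl.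
rewrite -[I * f q * I]mulrA mulII mulNr mulIIr opprK.
by apply/rowP => i; rewrite !quat_coordE; field.
Qed.

Lemma sandwich_comm f q : GRing.comm I (sandwich (-1) f q).
Proof.
rewrite /GRing.comm /sandwich -qscalerAr -qscalerAl; congr (_ *: _).
rewrite mulrDr mulrDl -qscalerAr -qscalerAl mulIIr -[I * f q * I]mulrA mulII.
by qlinear.
Qed.

Lemma sandwich_anticomm f q : I * sandwich 1 f q = - (sandwich 1 f q * I).
Proof.
rewrite /sandwich !scale1r -qscalerAr -qscalerAl -scalerN; congr (_ *: _).
rewrite mulrDr mulrDl mulIIr -[I * f q * I]mulrA mulII.
by qlinear.
Qed.

(** After the first [dbar] the left factor is [sandwich I 1 f], again Cauchy-Riemann and fixed by
    the sandwich; each further [dbar] only moves [gk] one derivative on. *)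
Lemma iter_dbar_mul f g (gk : nat -> quat R -> quat R) :
  (forall q, differentiable f q) -> slice_CR f ->
  (forall k q, differentiable (gk k) q) -> gk 0%N = g ->
  (forall k q, slice I q -> 'D_1 (gk k) q = gk k.+1 q) ->
  (forall k, slice_CR (gk k)) ->
  forall k q, slice I q ->
    iter k.+1 (dbar I) (f \* g) q = sandwich 1 f q * gk k.+1 q.
Proof.
move=> df Cf dg <- Dg Cg; elim=> [|k IH] q hq.
  by rewrite /= dbar_mul// Dg.
rewrite iterS (@dbar_eq_slice _ (sandwich 1 f \* gk k.+1)) => [|p hp|] //; last exact: IH.
rewrite dbar_mul//; last exact: sandwich_CR.
  by rewrite Dg// sandwich_idem.
by move=> p; exact: sandwich_differentiable.
Qed.

End SliceCalculus.

(** * The splitting of a slice regular function *)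

Section Splitting.
Variables (R : realType) (I J : quat R).
Hypotheses (hI : imag_units I) (hJ : imag_units J) (IJ : perp I J).
Implicit Types (f g F G : quat R -> quat R) (p q v : quat R).

(** The limit is 'D_1 F, which commutes with I because F does on the slice; convergence is the
    uniform Taylor estimate divided by q - p. *)
Lemma holomorphic_comm F : of_class 1 F -> slice_CR I F ->
  (forall q, slice I q -> slice I (F q)) -> holomorphic_on_slice I F.
Proof.
move=> cF CF FI p hp; have [dF _] := cF.
have l : slice I ('D_1 F p).
  apply/(sliceP _ hI); rewrite /GRing.comm -derive_qmull// -derive_qmulr//.
  apply: (derive_eq_slice _ hp (slice1 I)) => q hq /=.
  exact: (slice_mulC (slice_unit I) (FI q hq)).
exists ('D_1 F p) => //.
apply/cvgrPdist_le => /= e e0.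
have e40 : 0 < e / 4 by rewrite divr_gt0.
(* The radius |p| + 1 leaves room for q with |q - p| < 1. *)
have [d d0 hd] := slice_taylor hI cF (slice_CR_dbar hI CF) (`|p| + 1) e40.
have d1 : 0 < Num.min d 1 by rewrite lt_min d0 ltr01.
rewrite near_withinE; near=> q => hq.
have qp : q != p by near: q; exact: nbhs_dnbhs_neq.
have qd : `|q - p| < Num.min d 1.
  by near: q; apply: nbhs_dnbhs; exact: (@cvgr_distC_lt R (quat R) _ (nbhs p) _ id p).
have qp0 : q - p != 0 by rewrite subr_eq0.
have n0 : 0 < `|q - p| by rewrite normr_gt0.
have hqp : slice I (q - p) by apply: sliceB.
have -> : 'D_1 F p - (F q - F p) / (q - p) =
    - ((F (p + (q - p)) - F p - (q - p) * 'D_1 F p) / (q - p)).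
  rewrite [p + _]addrC subrK; move: (F q - F p) => A.
  rewrite mulrBl opprB; congr (_ - _).
  by rewrite (slice_mulC hqp l) mulrK// qunit.
move: qd; rewrite lt_min => /andP[qd q1].
have /hd h : slice I p by [].
have {}h := h _ hqp.
rewrite normrN; apply: le_trans (qnormM _ _) _.
have le1 : `|F (p + (q - p)) - F p - (q - p) * 'D_1 F p| <= e / 4 * `|q - p|.
  apply: h => //; first by rewrite lerDl.
  by apply: le_trans (ler_normD _ _) _; rewrite lerD2l ltW.
apply: (@le_trans _ _ (4 * (e / 4 * `|q - p| * `|q - p|^-1))).
  by rewrite ler_wpM2l//; apply: ler_pM => //; exact: qnV.
by rewrite mulfK ?gt_eqF// mulrC divfK.
Unshelve. all: by end_near. Qed.

(** F commutes with I, so F + I F I = 0; G J anticommutes with I, so I (G J) I = G J. Thus G J is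
    the same for every splitting with the given J. *)
Lemma splitting_sandwich f F G : splitting I J f F G ->
  forall q, slice I q -> sandwich I 1 f q = G q * J.
Proof.
move=> [FI _ GI _ fE] q hq; rewrite /sandwich fE// scale1r.
have JI : J * I = - (I * J) by rewrite (perp_anticomm hI hJ IJ) opprK.
rewrite mulrDr mulrDl (slice_mulC (slice_unit I) (FI q hq)) mulIIr//.
rewrite mulrA (slice_mulC (slice_unit I) (GI q hq)) -mulrA -mulrA.
rewrite JI mulrN mulII// opprK.
by apply/rowP => i; rewrite !quat_coordE; field.
Qed.

(** G is recovered from G J by multiplying with -J, the inverse of J; a product of two elements that
    anticommute with I commutes with I. *)
Lemma splitting_exists f : of_class 1 f -> slice_CR I f ->
  splitting I J f (sandwich I (-1) f) (sandwich I 1 f \* cst (- J)).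
Proof.
move=> cf Cf; have [df _] := cf.
have dP q : differentiable (sandwich I 1 f) q by exact: sandwich_differentiable.
have F_slice q : slice I (sandwich I (-1) f q).
  by apply/sliceP => //; exact: sandwich_comm.
have G_slice q : slice I ((sandwich I 1 f \* cst (- J)) q).
  apply/sliceP => //; rewrite /GRing.comm /= mulrA sandwich_anticomm//.
  by rewrite !mulrN !mulNr opprK -!mulrA (perp_anticomm hI hJ IJ) mulrN.
split.
- by move=> q _; exact: F_slice.
- exact: (holomorphic_comm (sandwich_class I (-1) cf) (sandwich_CR (-1) df Cf)
    (fun q _ => F_slice q)).
- by move=> q _; exact: G_slice.
- apply: (holomorphic_comm _ _ (fun q _ => G_slice q)).
    exact: of_class_qmul (sandwich_class I 1 cf) (of_class_cst 1 _).
  by move=> q hq; rewrite !derive_qmulr// (sandwich_CR 1 df Cf hq) mulrA.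
- move=> q _ /=; rewrite -mulrA mulNr -expr2 hJ opprK mulr1.
  by rewrite sandwich_split.
Qed.

End Splitting.

(** * Derivatives of the power series within a slice *)

Section Powers.
Variables (R : realType) (a : (quat R)^nat).
Hypothesis entire_a : entire a.
Implicit Types (I q v : quat R).

Local Notation gk k := (pser a (nseq k 1)).

Lemma pser_nseq_derive I k q v : slice I q -> slice I v ->
  'D_v (gk k) q = v * gk k.+1 q.
Proof.
move=> hq hv; have [_ ->] := pser_diff entire_a (nseq k 1) q.
rewrite pser_commute//; first exact: slice_mulC hv hq.
by move=> w; rewrite mem_nseq => /andP[_ /eqP->]; rewrite /GRing.comm mulr1 mul1r.
Qed.

Lemma pser_slice_CR I k : slice_CR I (gk k).
Proof.
move=> q hq; rewrite (pser_nseq_derive k hq (slice_unit I)).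
by rewrite (pser_nseq_derive k hq (slice1 I)) mul1r.
Qed.

Lemma iter_slice_dy I k q : imag_units I -> slice I q ->
  iter k (slice_dy I) (pser a [::]) q = I ^+ k * gk k q.
Proof.
move=> hI; elim: k q => [|k IH] q hq; first by rewrite expr0 mul1r.
rewrite iterS /slice_dy (@derive_eq_slice _ I _ (cst (I ^+ k) \* gk k)) //=.
  rewrite derive_qmull; last by have [] := pser_diff entire_a (nseq k 1) q.
  by rewrite (pser_nseq_derive k hq (slice_unit I)) exprSr mulrA.
exact: slice_unit.
Qed.

End Powers.

(** * Iterated [dbar] of the pointwise product *)

Section DotProduct.
Variables (R : realType) (f g : quat R -> quat R).
Hypotheses (hf : slice_regular f) (hg : slice_regular g).
Implicit Types (I q : quat R).

(** The power series upgrades class C^1 to every class, which supplies the smoothness of f g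
    demanded at each level. *)
Lemma slice_regular_of_class (h : quat R -> quat R) k :
  slice_regular h -> of_class k h.
Proof. by move=> /slice_regular_pser [a ea ->]; exact: pser_of_class. Qed.

Lemma slice_regular_CR (h : quat R -> quat R) I :
  slice_regular h -> imag_units I -> slice_CR I h.
Proof. by move=> /slice_regular_pser [a ea ->] hI; exact: (pser_slice_CR ea 0). Qed.

(** One sequence [gk], the iterated derivatives of g along 1, serves all slices at once. *)
Lemma iter_dbar_dot : exists gk : nat -> quat R -> quat R,
  forall I, imag_units I -> forall q, slice I q ->
  (forall k, iter k.+1 (dbar I) (f \* g) q = sandwich I 1 f q * gk k.+1 q) /\
  (forall k, iter k (slice_dy I) g q = I ^+ k * gk k q).
Proof.
have [a ea ga] := slice_regular_pser hg.
exists (fun k => pser a (nseq k 1)) => I hI q hq; split=> k; last first.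
  by rewrite ga; exact: iter_slice_dy.
have [df _] := slice_regular_of_class 1 hf.
apply: (iter_dbar_mul hI (gk := fun k => pser a (nseq k 1)) df) => //.
- exact: slice_regular_CR.
- by move=> j p; have [] := pser_diff ea (nseq j 1) p.
- by move=> j p hp; rewrite (pser_nseq_derive ea j hp (slice1 I)) mul1r.
- by move=> j; exact: pser_slice_CR.
Qed.

End DotProduct.

Theorem theorem3p2 (R : realType) (f g : quat R -> quat R)
    (hf : slice_regular f) (hg : slice_regular g) :
  ((forall I, imag_units I -> maps_slice I f) -> slice_regular (f \* g))
  /\
  (S_polyregular (f \* g) <->
   exists k0 : nat, (0 < k0)%N /\
     forall I, imag_units I ->
     forall (J : quat R) (F G : quat R -> quat R),
       imag_units J -> perp I J -> splitting I J f F G ->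
       zeros I G `|` zeros I (iter k0 (slice_dy I) g) = slice I).
Proof.
have [gk hgk] := iter_dbar_dot hf hg.
have fg_class k : of_class k (f \* g).
  by apply: of_class_qmul; exact: slice_regular_of_class.
have unit_neq0 (I : quat R) : imag_units I -> I != 0.
  move=> hI; apply/eqP => I0; move: hI; rewrite /imag_units /= I0 expr0n /=.
  by move=> /eqP; rewrite eq_sym oppr_eq0 oner_eq0.
have mulI_eq0 (I q : quat R) k : imag_units I -> I ^+ k * q = 0 -> q = 0.
  move=> hI h; have Iu : I ^+ k \is a GRing.unit by rewrite unitrX// qunit// unit_neq0.
  by rewrite -[q](mulKr Iu) h mulr0.
split=> [fI|].
  split=> // I hI q hq; have [-> _] := hgk I hI q hq.
  (* Values of f in the slice commute with I, so the anticommuting part of f vanishes and a single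
     [dbar] gives 0. *)
  suff -> : sandwich I 1 f q = 0 by rewrite mul0r.
  rewrite /sandwich (slice_mulC (slice_unit I) (fI I hI q hq)) mulIIr//.
  by rewrite scale1r subrr scaler0.
split=> [[n [_ hn]]|[k0 [k00 hk0]]].
  (* Level n means n + 1 applications of [dbar], and n + 1 is positive. *)
  exists n.+1; split=> // I hI J F G hJ IJ spl.
  apply/seteqP; split=> [q [[]|[]]//|q hq].
  have [e1 e2] := hgk I hI q hq.
  have := hn I hI q hq; rewrite e1 (splitting_sandwich hI hJ IJ spl hq).
  move=> /quat_mul_eq0[/quat_mul_eq0[G0|/eqP J0]|g0].
  - by left.
  - by rewrite (negPf (unit_neq0 J hJ)) in J0.
  - by right; split=> //; rewrite e2 g0 mulr0.
exists k0.-1; rewrite /SR_level prednK//; split=> // I hI q hq.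
(* The zero condition speaks of all splittings, so it is applied to the explicit one. *)
have [J hJ IJ] := perp_exists hI.
have spl := splitting_exists hI hJ IJ (slice_regular_of_class 1 hf)
  (slice_regular_CR hf hI).
have [e1 e2] := hgk I hI q hq.
have : slice I q by [].
rewrite -(hk0 I hI J _ _ hJ IJ spl) -(prednK k00) e1 (splitting_sandwich hI hJ IJ spl hq).
move=> [[_ ->]|[_]]; first by rewrite !mul0r.
(* I^k0 is invertible, so a zero of the y-derivative is a zero of [gk k0]. *)
by rewrite e2 => /(mulI_eq0 _ _ _ hI) ->; rewrite mulr0.
Qed.
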